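(* Let $K$ be an arbitrary field. (1) If $M$ is a finite matroid on $E$ that is the direct sum of connected matroids $M_1,M_2$ on the sets $E_1,E_2$ respectively, where $E_1\cap E_2=\emptyset$ and $E=E_1\cup E_2$, then $$\mathrm{Gal}(\hat Z_M/K(\mathbf{v}))\cong\mathrm{Gal}(\hat Z_{M_1}/K(\mathbf{v}_{E_1}))\times\mathrm{Gal}(\hat Z_{M_2}/K(\mathbf{v}_{E_2})).$$ (2) For any finite matroid $M$ on $E$, the Galois group $\mathrm{Gal}(\hat Z_M/K(\mathbf{v}))$ of its multivariate Tutte polynomial is a direct product of symmetric groups corresponding to the connected direct summands of $M$: if $M=M_1\oplus\cdots\oplus M_k$ with each $M_i$ connected, then $\mathrm{Gal}(\hat Z_M/K(\mathbf{v}))\cong S_{r(M_1)}\times\cdots\times S_{r(M_k)}$.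
   Context: Let $M$ be a finite matroid on the ground set $E$ with rank function $r_M$; its rank is $r(M)=r_M(E)$. A matroid on a non-empty ground set is connected if any two distinct elements of its ground set lie in a common circuit (equivalently, it is not a direct sum of two matroids on non-empty ground sets); every finite matroid is the direct sum of its connected components. For each $e\in E$ let $v_e$ be a variable, with all these variables algebraically independent over $K$; let $\mathbf{v}=\{v_e\}_{e\in E}$ and, for $A\subseteq E$, $\mathbf{v}_A=\{v_e\}_{e\in A}$. With a further variable $q$, the multivariate Tutte polynomial of $M$ is $$\hat Z_M=\hat Z_M(q,\mathbf{v})=\sum_{A\subseteq E}q^{\,r(M)-r_M(A)}\prod_{e\in A}v_e,$$ with integer coefficients interpreted in $K$, regarded as a polynomial in $q$ over $K(\mathbf{v})$. For a matroid $M_i$ on $E_i\subseteq E$, $\hat Z_{M_i}$ is defined in the same way with the variables $\mathbf{v}_{E_i}$. $\mathrm{Gal}(f/F)$ denotes the Galois group over $F$ of a splitting field of the polynomial $f\in F[q]$; it is trivial if $f$ is a non-zero constant. $S_m$ is the symmetric group of degree $m$, with $S_0$ trivial (so a rank-zero connected summand, i.e. a loop, contributes the trivial group). *)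

(* Defs.v *)
From HB Require Import structures.
From Stdlib Require Import Classical_Prop.
From mathcomp Require Import all_boot all_order all_fingroup all_algebra all_solvable all_field.
From mathcomp Require Import mpoly.

Set Implicit Arguments.
Unset Strict Implicit.
Unset Printing Implicit Defensive.

Import GRing.Theory.
Local Open Scope ring_scope.

Record matroid (E : finType) := Matroid {
  indep : {set {set E}};
  indep0 : set0 \in indep;
  indep_sub : forall A B : {set E}, A \subset B -> B \in indep -> A \in indep;
  indep_aug : forall A B : {set E}, A \in indep -> B \in indep -> (#|A| < #|B|)%N ->
    exists2 x, x \in B :\: A & x |: A \in indep
}.

Section Matroids.

Variables (E : finType) (M : matroid E).
Implicit Types A C : {set E}.

Definition mrk A : nat := \max_(I in indep M | I \subset A) #|I|.

Definition mrank : nat := mrk [set: E].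

Definition circuit C : bool := minset (fun A => A \notin indep M) C.

Definition connected_matroid : Prop :=
  (0 < #|E|)%N /\
  forall e f : E, e != f -> exists C, [/\ circuit C, e \in C & f \in C].

End Matroids.

(* A matroid on a subset A of E is a matroid on the finite type
   {x : E | x \in A}; [val @^-1: X] is then X :&: A, for X : {set E}. *)
Definition direct_sum2 (E : finType) (E1 E2 : {set E}) (M : matroid E)
    (M1 : matroid {x : E | x \in E1}) (M2 : matroid {x : E | x \in E2}) : Prop :=
  [/\ E1 :&: E2 = set0, E1 :|: E2 = [set: E] &
      forall X : {set E}, (X \in indep M) =
        (val @^-1: X \in indep M1) && (val @^-1: X \in indep M2)].

Definition direct_sum (E I : finType) (E_ : I -> {set E}) (M : matroid E)
    (M_ : forall i, matroid {x : E | x \in E_ i}) : Prop :=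
  [/\ forall i j, i != j -> E_ i :&: E_ j = set0,
      \bigcup_i E_ i = [set: E] &
      forall X : {set E}, (X \in indep M) =
        [forall i, val @^-1: X \in indep (M_ i)]].

(* The field K(v) of rational functions in variables v_e, e : E; the variables
   are numbered by enum_rank. For a matroid on a subset A of E the index type is
   {x : E | x \in A}, which gives (an isomorphic copy of) K(v_A). *)
Definition Kv (K : fieldType) (E : finType) : fieldType :=
  {fraction {mpoly K[#|E|]}}.

Definition var (K : fieldType) (E : finType) (e : E) : Kv K E :=
  tofrac ('X_(enum_rank e) : {mpoly K[#|E|]}).

Definition tutte (K : fieldType) (E : finType) (M : matroid E) :
    {poly Kv K E} :=
  \sum_(A : {set E}) (\prod_(e in A) var K e) *: 'X^(mrank M - mrk M A).

Definition splitting_field (F : fieldType) (p : {poly F})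
    (L : splittingFieldType F) : Prop :=
  splittingFieldFor 1%VS (map_poly (in_alg L) p) {:L}%VS.

(* Splitting fields exist, so that quantifying over all of them is not
   vacuous. *)
Lemma exists_irreducible_factor (F : fieldType) (p : {poly F}) :
  (1 < size p)%N -> exists2 r : {poly F}, r %| p & irreducible_poly r.
Proof.
have [n] := ubnP (size p); elim: n p => // n IHn p le_p_n p_gt1.
have [|red_p] := classic (irreducible_poly p); first by exists p.
have [q [q_gt1 q_dv_p q_neq_p]] :
    exists q : {poly F}, [/\ size q != 1%N, q %| p & ~~ (q %= p)].
  apply: NNPP => no_q; case: red_p; split=> // q q1 q_dv_p.
  by apply/negPn/negP => q_p; case: no_q; exists q.
have p_neq0 : p != 0 by rewrite -size_poly_gt0 ltnW.
have q_gt0 : (0 < size q)%N by rewrite size_poly_gt0 (dvdpN0 q_dv_p).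
have lt_q_p : (size q < size p)%N.
  by rewrite ltn_neqAle dvdp_size_eqp // q_neq_p dvdp_leq.
have [||r r_q irr_r] := IHn q.
- exact: leq_trans lt_q_p _.
- by rewrite ltn_neqAle eq_sym q_gt1.
by exists r => //; apply: dvdp_trans q_dv_p.
Qed.

Lemma exists_splits (F : fieldType) (p : {poly F}) : p != 0 ->
  exists (L : fieldExtType F) (zs : seq L),
    map_poly (in_alg L) p %= \prod_(z <- zs) ('X - z%:P).
Proof.
have [n] := ubnP (size p).
elim: n F p => // n IHn F p; rewrite ltnS => le_p_n p_neq0.
have [Cp | C'p] := leqP (size p) 1.
  exists F^o, [::].
  by rewrite big_nil -size_poly_eq1 size_map_poly eqn_leq Cp size_poly_gt0.
have [r r_dv_p irr_r] := exists_irreducible_factor C'p.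
have [K _ [x rx0 _]] := irredp_FAdjoin irr_r.
have /factor_theorem[q Dp] : root (map_poly (in_alg K) p) x.
  by rewrite -(divpK r_dv_p) rmorphM rootM rx0 orbT.
have Dszp : size p = size (q * ('X - x%:P)) by rewrite -Dp size_map_poly.
have q_neq0 : q != 0.
  by move: p_neq0; rewrite -size_poly_eq0 Dszp size_poly_eq0 mulf_eq0 => /norP[].
have [|L [zs Dq]] := IHn K q _ q_neq0.
  by move: le_p_n; rewrite Dszp size_mul ?polyXsubC_eq0 ?size_XsubC ?addn2.
exists (baseFieldType L), (x%:A :: zs).
rewrite -[map_poly _ _](eq_map_poly (fun a : F => baseField_scaleE (L := L) a 1)).
rewrite (map_poly_comp (in_alg L) (in_alg K)).
rewrite big_cons Dp mulrC rmorphM /= rmorphB /= map_polyX map_polyC /=.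
by rewrite eqp_mull.
Qed.

Lemma exists_splitting_field (F : fieldType) (p : {poly F}) : p != 0 ->
  exists L : splittingFieldType F, splitting_field p L.
Proof.
move=> /exists_splits[L [ys Dp]].
suffices [L' splitL'] : exists L' : fieldExtType F,
    splittingFieldFor 1%VS (map_poly (in_alg L') p) {:L'}%VS.
  have splitP : splitting_field_axiom L'.
    by exists (map_poly (in_alg L') p) => //; apply/polyOver1P; exists p.
  pose L'' : splittingFieldType F := HB.pack (L' : Type) L'
    (FieldExt_isSplittingField.Build F L' splitP).
  by exists L''.
pose Lp := subvs_of <<1 & ys>>; pose toL := linfun (vsval : Lp -> L).
have [zs Dys] : {zs | map toL zs = ys}.
  exists (map (vsproj _) ys); rewrite -map_comp map_id_in // => y ys_y.
  by rewrite /= lfunE /= vsprojK ?seqv_sub_adjoin.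
exists Lp, zs.
  set lhs := (lhs in lhs %= _); set rhs := (rhs in _ %= rhs).
  suffices: map_poly toL lhs %= map_poly toL rhs by rewrite eqp_map.
  rewrite -Dys big_map in Dp; apply: etrans Dp; apply: congr2.
    by rewrite -map_poly_comp; apply/eq_map_poly=> x; apply: rmorph_alg.
  rewrite rmorph_prod; apply/eq_bigr=> z _.
  by rewrite rmorphB /= map_polyX map_polyC.
set Lzs := LHS; pose Lys := (toL @: Lzs)%VS; apply/vspaceP=> u.
have: val u \in Lys by rewrite /Lys aimg_adjoin_seq aimg1 Dys (valP u).
by case/memv_imgP=> v Lzs_v; rewrite memvf lfunE => /val_inj->.
Qed.

(* Main.v *)
Require Import Defs.
From HB Require Import structures.
From Stdlib Require Import Classical_Prop.
From mathcomp Require Import all_boot all_order all_fingroup all_algebra all_solvable all_field.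
From mathcomp Require Import mpoly.
From mathcomp Require Import zify.

Set Implicit Arguments.
Unset Strict Implicit.
Unset Printing Implicit Defensive.

Import GRing.Theory.

(** The polynomial attached to a minor of a matroid with ground set [S] and
    contracted set [C] is a sum over the subsets of [S]; connected minors are
    described by the rank function, and [minor_connected_step] is the theorem of
    Tutte that deleting or contracting an element of a connected matroid leaves
    at least one connected matroid.

    That a polynomial of degree n has Galois group S_n, with distinct roots, is
    expressed without Galois groups by the predicate [full]: the n! monomials in
    the roots in which the i-th root (counted from 0) has degree less than n - i
    are linearly independent. This property passes to subfields ([full_descent])
    and lifts from a specialization of the coefficients ([full_specialization]),
    both by [conjugate_relation]: the product of all conjugates of a relation
    between the roots is a polynomial in the coefficients, hence a relation
    between the roots survives any ring morphism up to a reordering of the roots.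

    For a connected matroid M of rank n, the Tutte polynomial is shown to be full
    by induction on the number of elements ([minor_full]). If e is an element,
    it is f + v g, where v is the variable of e, and f and g are the polynomials
    of the deletion and of the contraction of e. If the deletion is connected,
    specialize v to 0. If the contraction is connected, let v tend to infinity:
    one root t of f + v g becomes infinite and the others tend to the roots of g.
    As v = - f(t) / g(t), everything takes place over the field k(t), where the
    specialization 1/t = 0 shows that the quotient of f + v g by q - t is full;
    and t has degree n over k(v), because f and g are coprime ([full_pencil]).
    They are coprime because otherwise the irreducible polynomial g would divide
    f; but when all variables are replaced by a single y, both are monic in y
    with the same degree, so they would coincide, although their degrees in q
    are different ([minor_tutte_ndvd]).

    The Tutte polynomial of a direct sum is the product of those of its summands
    ([tutte_prod]). The result for connected matroids holds over every field, in
    particular over a field that contains the roots belonging to the other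
    summands; therefore the i-th factor, of degree r_i, is still full over the
    field generated by the roots of the other factors ([independent_roots]), and
    the Galois group contains permutations of the roots of the i-th factor which
    realize all of S_(r_i) and fix the other roots. So the embedding of the
    Galois group into the product of these symmetric groups is onto
    ([gal_components]). *)

(** * Connected minors of a matroid *)

Section Rank.
Variables (E : finType) (M : matroid E).
Implicit Types A B C D I J S X Y Z : {set E}.
Local Notation r := (mrk M).

Lemma mrk_max I A : I \in indep M -> I \subset A -> #|I| <= r A.
Proof.
move=> MI IA; rewrite /mrk.
by apply: (bigop.leq_bigmax_cond (F := fun I : {set E} => #|I|)); rewrite MI.
Qed.

Lemma mrk_basis A : exists2 I, I \in indep M & I \subset A /\ #|I| = r A.
Proof.
have ne : 0 < #|[pred I in indep M | I \subset A]|.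
  by apply/card_gt0P; exists set0; rewrite inE indep0 sub0set.
have [I /andP[MI IA] Dr] := bigop.eq_bigmax_cond (fun I : {set E} => #|I|) ne.
by exists I => //; split=> //; apply: esym.
Qed.

Lemma mrk_extend I A : I \in indep M -> I \subset A ->
  exists2 J, J \in indep M & [/\ I \subset J, J \subset A & #|J| = r A].
Proof.
have [k] := ubnP (r A - #|I|); elim: k I => // k IHk I lt_k MI IA.
have [B MB [BA cB]] := mrk_basis A.
have [le_BI | lt_IB] := leqP #|B| #|I|.
  exists I => //; split=> //; apply/eqP; rewrite eqn_leq mrk_max //.
  by rewrite -cB.
have [x /setDP[Bx I'x] MxI] := indep_aug MI MB lt_IB.
have [||J MJ [xIJ JA cJ]] := IHk (x |: I) _ MxI.
- by rewrite cardsU1 I'x; lia.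
- by rewrite subUset sub1set (subsetP BA) ?IA.
by exists J => //; split=> //; apply: subset_trans xIJ; apply: subsetUr.
Qed.

Lemma mrkS A B : A \subset B -> r A <= r B.
Proof.
by move=> AB; have [I MI [IA <-]] := mrk_basis A; apply: mrk_max (subset_trans IA AB).
Qed.

Lemma mrk_card A : r A <= #|A|.
Proof. by have [I _ [IA <-]] := mrk_basis A; apply: subset_leq_card. Qed.

Lemma mrk0 : r set0 = 0.
Proof. by apply/eqP; rewrite -leqn0 -(cards0 E) mrk_card. Qed.

Lemma mrkU1 x A : r (x |: A) <= (r A).+1.
Proof.
have [J MJ [JxA <-]] := mrk_basis (x |: A).
rewrite (cardsD1 x J) -add1n leq_add ?leq_b1 // mrk_max ?subDset //.
by apply: indep_sub MJ; apply: subsetDl.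
Qed.

(** A maximal independent subset [I] of the intersection extends to one of the
    union, whose traces on [A] and [B] meet in [I]. *)
Lemma mrk_submod A B : r (A :|: B) + r (A :&: B) <= r A + r B.
Proof.
have [I MI [IAB cI]] := mrk_basis (A :&: B).
have [|J MJ [IJ JAB cJ]] := @mrk_extend I (A :|: B) MI.
  by rewrite (subset_trans IAB) // subIset // subsetUl.
have leJ X : #|J :&: X| <= r X.
  by apply: mrk_max (subsetIr _ _); apply: indep_sub MJ; apply: subsetIl.
apply: leq_trans (leq_add (leJ A) (leJ B)).
rewrite -cardsUI -setIUr (setIidPl JAB) cJ leq_add2l -cI subset_leq_card //.
by rewrite -setIIr subsetI IJ.
Qed.

Lemma indep_mrk A : (A \in indep M) = (r A == #|A|).
Proof.
apply/idP/eqP => [MA|]; first by apply/eqP; rewrite eqn_leq mrk_card mrk_max.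
have [I MI [IA <-]] := mrk_basis A => cIA.
by have /eqP <- : I == A by rewrite eqEcard IA cIA leqnn.
Qed.

(** The minor with ground set [S] obtained by contracting [C] and deleting the
    remaining elements, whose rank function is [r (A :|: C) - r C], is not a
    direct sum of two nonempty matroids. *)
Definition minor_connected S C : bool :=
  (S != set0) && [forall A : {set E}, (A \proper S) && (A != set0) ==>
    (r (S :|: C) + r C < r (A :|: C) + r (S :\: A :|: C))].

Lemma minor_connectedP S C : reflect
  (S != set0 /\ forall A, A \proper S -> A != set0 ->
    r (S :|: C) + r C < r (A :|: C) + r (S :\: A :|: C)) (minor_connected S C).
Proof.
apply: (iffP andP) => -[S0 conn]; split=> //.
  by move=> A SA A0; move/forallP/(_ A): conn; rewrite SA A0.
by apply/forallP => A; apply/implyP => /andP[]; apply: conn.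
Qed.

Lemma minor_connected_nonloop S C e : minor_connected S C -> e \in S -> S :\ e != set0 ->
  r (e |: C) = (r C).+1 /\ r (S :\ e :|: C) = r (S :|: C).
Proof.
case/minor_connectedP=> _ conn Se S'0.
have p1 : [set e] \proper S.
  rewrite properEneq sub1set Se andbT.
  by apply: contraNneq S'0 => <-; rewrite setDv.
have p2 : [set e] != set0 by apply/set0Pn; exists e; rewrite inE.
have := conn _ p1 p2.
have := mrkU1 e C; have := mrkS (setSU C (subD1set S e)).
by lia.
Qed.

(** Suppose that [A], [B] separate the deletion of [e], and [X], [Y] its
    contraction. Adding the submodularity inequalities for [A], [X] and for
    [B], [Y] shows that one of the intersections of [A] with [X] and of [B] with
    [Y] is empty, as otherwise each of them would contradict the connectedness
    of [S]. The same holds for [A] with [Y] and [B] with [X], and so one of the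
    four sets is empty. *)
Lemma minor_connected_step S C e : minor_connected S C -> e \in S -> S :\ e != set0 ->
  minor_connected (S :\ e) C \/ minor_connected (S :\ e) (e |: C).
Proof.
move=> connS Se S'0; have [re rS'] := minor_connected_nonloop connS Se S'0.
apply/orP; apply: contraT; rewrite negb_or /minor_connected S'0 /= !negb_forall.
have DSC : S :\ e :|: (e |: C) = S :|: C by rewrite setUCA setUA setD1K.
case/andP=> /existsP[A]; rewrite negb_imply -leqNgt => /andP[/andP[AS A0] leA].
case/existsP=> X; rewrite negb_imply -leqNgt => /andP[/andP[XS X0] leX].
move: leA leX; rewrite rS' re DSC.
have compl0 Z : Z \proper S :\ e -> (S :\ e) :\: Z != set0.
  by case/properP=> _ [x S'x Zx]; apply/set0Pn; exists x; rewrite inE Zx.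
move: (proper_sub AS) (proper_sub XS) (compl0 _ AS) (compl0 _ XS).
set B := _ :\: A; set Y := _ :\: X => sA sX B0 Y0 leA leX.
have gap Z : Z \subset S :\ e ->
  r (S :|: C) + r C + (Z != set0) <= r (Z :|: C) + r (S :\: Z :|: C).
  move=> sZ; have [->|Z0] := eqVneq Z set0; first by rewrite setD0 set0U addn0 addnC.
  case/minor_connectedP: connS => _ /(_ Z).
  rewrite addn1; apply=> //; apply: sub_proper_trans sZ _.
  by rewrite properEneq subD1set andbT; apply/eqP=> Dx; move: Se; rewrite -{1}Dx !inE eqxx.
(* Submodularity for P :|: C and Q :|: (e |: C). *)
have exch P Q : r (P :&: Q :|: C) + r (P :|: Q :|: (e |: C)) <= r (P :|: C) + r (Q :|: (e |: C)).
  rewrite addnC; apply: leq_trans (mrk_submod _ _); apply: leq_add; apply: mrkS.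
    apply/subsetP=> z; rewrite !inE.
    by case: (z \in P); case: (z \in Q); case: (z \in C); rewrite ?orbT.
  apply/subsetP=> z; rewrite !inE.
  by case: (z \in P); case: (z \in Q); case: (z \in C); rewrite ?orbT.
have compl P Q P' Q' : P' = S :\ e :\: P -> Q' = S :\ e :\: Q ->
    P \subset S :\ e -> Q \subset S :\ e ->
  P :|: Q :|: (e |: C) = S :\: (P' :&: Q') :|: C.
  move=> -> -> /subsetP sP /subsetP sQ; apply/setP=> z.
  move/implyP: (sP z) => +; move/implyP: (sQ z) => +; rewrite !inE.
  have [->|_] := eqVneq z e; rewrite ?Se.
    by case: (e \in P); case: (e \in Q); case: (e \in C).
  by case: (z \in P); case: (z \in Q); case: (z \in C); case: (z \in S).
have meets (P Q : {set E}) : P \subset S :\ e -> P != set0 ->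
  (P :&: Q != set0) || (P :&: (S :\ e :\: Q) != set0).
  move=> sP /set0Pn[z Pz]; have [Qz|Q'z] := boolP (z \in Q).
    by apply/orP; left; apply/set0Pn; exists z; rewrite inE Pz.
  apply/orP; right; apply/set0Pn; exists z.
  by rewrite inE Pz inE Q'z (subsetP sP).
have DA : A = S :\ e :\: B by rewrite setDDr setDv set0U (setIidPr sA).
have DX : X = S :\ e :\: Y by rewrite setDDr setDv set0U (setIidPr sX).
have sB : B \subset S :\ e := subsetDl _ _; have sY : Y \subset S :\ e := subsetDl _ _.
have at_most_one (P Q P' Q' : {set E}) : P' = S :\ e :\: P -> Q' = S :\ e :\: Q ->
    P = S :\ e :\: P' -> Q = S :\ e :\: Q' ->
    r (P :|: C) + r (P' :|: C) <= r (S :|: C) + r C ->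
    r (Q :|: (e |: C)) + r (Q' :|: (e |: C)) <= r (S :|: C) + (r C).+1 ->
  (P :&: Q != set0) && (P' :&: Q' != set0) = false.
  move=> DP' DQ' DP DQ leP leQ; apply/negP => /andP[PQ PQ'].
  have sP : P \subset S :\ e by rewrite DP subsetDl.
  have sQ : Q \subset S :\ e by rewrite DQ subsetDl.
  have sP' : P' \subset S :\ e by rewrite DP' subsetDl.
  have sQ' : Q' \subset S :\ e by rewrite DQ' subsetDl.
  have := exch P Q; rewrite (compl _ _ _ _ DP' DQ' sP sQ).
  have := exch P' Q'; rewrite (compl _ _ _ _ DP DQ sP' sQ').
  have := gap _ (subset_trans (subsetIl P Q) sP); rewrite PQ.
  have := gap _ (subset_trans (subsetIl P' Q') sP'); rewrite PQ'.
  move: leP leQ; clear; move: (r _) (r _) (r _) (r _) (r _) (r _) (r _) (r _) (r _) (r _).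
  lia.
have := at_most_one _ _ _ _ erefl erefl DA DX leA leX; rewrite -/B -/Y.
rewrite addnC in leX; have := at_most_one A Y B X erefl DX DA erefl leA leX.
have := meets A X sA A0; have := meets B X sB B0; rewrite -/Y.
have := meets X A sX X0; have := meets Y A sY Y0; rewrite -/B.
rewrite ![X :&: _]setIC ![Y :&: _]setIC; clear.
by do 4!case: (_ != set0).
Qed.

(** The circuits of the minor in which [C] is contracted, in terms of the rank
    function of [M]. *)
Definition minor_circuit C D : bool :=
  ((r (D :|: C)).+1 == r C + #|D|) &&
  [forall (x | x \in D), (r (D :\ x :|: C)).+1 == r C + #|D|].

(** Induction on [S]: delete or contract an element [g] distinct from [e] and [f],
    keeping the minor connected. A circuit [D] of the contraction of [g] is
    either a circuit, or becomes one when [g] is added to it. *)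
Lemma minor_circuit_ex S C e f : minor_connected S C -> e \in S -> f \in S -> e != f ->
  exists2 D : {set E}, D \subset S & [/\ e \in D, f \in D & minor_circuit C D].
Proof.
have [k] := ubnP #|S|; elim: k S C => // k IHk S C; rewrite ltnS => le_S_k connS Se Sf ne_ef.
have [le_S_ef | ] := boolP (S \subset [set e; f]).
  have DS : S = [set e; f] by apply/eqP; rewrite eqEsubset le_S_ef subUset !sub1set Se.
  have cardS : #|S| = 2 by rewrite DS cards2 ne_ef.
  have De : S :\ e = [set f].
    by rewrite DS; apply/setP=> z; rewrite !inE; case: eqVneq => // ->; rewrite (negPf ne_ef).
  have Df : S :\ f = [set e].
    rewrite DS; apply/setP=> z; rewrite !inE.
    by case: (eqVneq z f) => [->|_]; rewrite ?orbF //= eq_sym (negPf ne_ef).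
  have ne x : [set x] != set0 :> {set E} by apply/set0Pn; exists x; rewrite inE.
  exists S => //; split=> //; rewrite /minor_circuit cardS.
  have [] := minor_connected_nonloop connS Se; rewrite De // => re rf.
  have [] := minor_connected_nonloop connS Sf; rewrite Df // => rf' _.
  rewrite -rf rf' addn2 eqxx /=; apply/forall_inP => x; rewrite DS !inE -DS.
  by case/orP=> /eqP->; rewrite ?De ?Df ?re ?rf'.
case/subsetPn=> g Sg; rewrite !inE negb_or => /andP[ne_ge ne_gf].
have S'e : e \in S :\ g by rewrite !inE eq_sym ne_ge.
have S'f : f \in S :\ g by rewrite !inE eq_sym ne_gf.
have S'0 : S :\ g != set0 by apply/set0Pn; exists e.
have lt_S' : #|S :\ g| < k by move: le_S_k; rewrite (cardsD1 g) Sg.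
have [rg _] := minor_connected_nonloop connS Sg S'0.
case: (minor_connected_step connS Sg S'0) => /IHk[] // D sD [De Df circD].
  by exists D => //; apply: subset_trans sD (subD1set _ _).
have D'g : g \notin D by apply/negP => /(subsetP sD); rewrite !inE eqxx.
case/andP: circD => /eqP rD /forall_inP rDx.
have DgE A : A :|: (g |: C) = g |: (A :|: C) by rewrite setUCA.
rewrite DgE rg in rD.
have {}rDx x : x \in D -> (r (g |: (D :\ x :|: C))).+1 = (r C).+1 + #|D|.
  by move/rDx/eqP; rewrite DgE rg.
have [indD | depD] := ltnP (r (D :|: C)) (r C + #|D|).
  exists D; first exact: subset_trans sD (subD1set _ _).
  split=> //; have rDg := mrkU1 g (D :|: C).
  apply/andP; split; first by apply/eqP; move: rD rDg indD; clear; lia.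
  apply/forall_inP => x Dx; apply/eqP.
  have := mrkS (setSU C (subD1set D x)); have := mrkU1 g (D :\ x :|: C).
  by move: (rDx x Dx) indD; clear; lia.
exists (g |: D); first by rewrite subUset sub1set Sg (subset_trans sD) ?subD1set.
split; rewrite ?inE ?De ?Df ?orbT //.
have leDg := mrkS (subsetUr [set g] (D :|: C)).
apply/andP; rewrite cardsU1 D'g -setUA; split; first by apply/eqP; move: rD; clear; lia.
apply/forall_inP => x; rewrite !inE => /predU1P[->|Dx]; apply/eqP.
  by rewrite setU1K //; move: depD leDg rD; clear; lia.
have -> : (g |: D) :\ x = g |: (D :\ x).
  apply/setP=> z; rewrite !inE; case: (eqVneq z g) => // ->; rewrite andbT.
  by apply: contraNneq D'g => ->.
by rewrite -setUA; move: (rDx x Dx); clear; lia.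
Qed.

Lemma circuit_of_minor D : minor_circuit set0 D -> circuit M D.
Proof.
case/andP=> /eqP; rewrite setU0 mrk0 add0n => rD /forall_inP rDx.
apply/minsetP; split; first by rewrite indep_mrk -rD; lia.
move=> A A_dep sAD; apply/eqP; rewrite eqEsubset sAD; apply/subsetP=> x Dx.
apply: contraR A_dep => A'x; apply: (@indep_sub _ M _ (D :\ x)).
  by rewrite subsetD1 sAD.
move: (rDx x Dx); rewrite setU0 indep_mrk (cardsD1 x D) Dx.
by rewrite add1n eqSS.
Qed.

Lemma separator_rank A B X : A :&: B = set0 -> r A + r B <= r (A :|: B) ->
  X \subset A :|: B -> r X = r (X :&: A) + r (X :&: B).
Proof.
move=> AB0 leAB sX; apply/eqP; rewrite eqn_leq; apply/andP; split.
  have := mrk_submod (X :&: A) (X :&: B).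
  by rewrite -setIUr (setIidPl sX) => /(leq_trans (leq_addr _ _)).
have := mrk_submod X A; have := mrk_submod (X :|: A) B.
have -> : (X :|: A) :&: B = X :&: B by rewrite setIUl AB0 setU0.
by move: leAB (mrkS (setSU B (subsetUr X A))); clear; lia.
Qed.

(** If [A] and its complement separate [M], a circuit that meets both would be the
    union of two proper, hence independent, subsets whose ranks add up. The
    converse is [minor_circuit_ex]. *)
Lemma connected_matroid_minor : connected_matroid M <-> minor_connected [set: E] set0.
Proof.
split=> [[E_gt0 connM] | connM].
  apply/minor_connectedP; split; first by rewrite -card_gt0 cardsT.
  move=> A /properP[_ [f _ A'f]] /set0Pn[e Ae]; rewrite !setU0 mrk0 addn0 setTD.
  rewrite ltnNge; apply/negP => leA.
  have ne_ef : e != f by apply: contraNneq A'f => <-.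
  have [D [/minsetP[D_dep minD] De Df]] := connM e f ne_ef.
  have indep_sub_D B : B \subset D -> B != D -> r B = #|B|.
    move=> sBD neBD; apply/eqP; rewrite -indep_mrk; apply: contraNT neBD => B_dep.
    by apply/eqP/minD.
  case/negP: D_dep; rewrite indep_mrk (@separator_rank A (~: A)) ?setICr ?setUCr ?subsetT //.
  rewrite !indep_sub_D ?subsetIl // -?setDE.
  - by rewrite cardsID.
  - by apply/eqP=> DA; move: De; rewrite -DA inE Ae.
  by apply/eqP=> DA; move: Df; rewrite -DA inE (negPf A'f) andbF.
split; first by case/minor_connectedP: connM => + _; rewrite -card_gt0 cardsT.
move=> e f ne_ef; have [||D _ [De Df /circuit_of_minor circD]] := minor_circuit_ex connM _ _ ne_ef.
- exact: in_setT.
- exact: in_setT.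
by exists D.
Qed.

(** Split [S] along separations as long as there are some. *)
Lemma connected_components S : exists ss : seq {set E},
  [/\ all (fun A => minor_connected A set0) ss, pairwise (fun A B => A :&: B == set0) ss,
      \bigcup_(A <- ss) A = S & forall X, X \subset S -> r X = \sum_(A <- ss) r (X :&: A)].
Proof.
have [k] := ubnP #|S|; elim: k S => // k IHk S; rewrite ltnS => le_S_k.
have [->|S0] := eqVneq S set0.
  exists [::]; split=> //; rewrite ?big_nil // => X.
  by rewrite subset0 => /eqP->; rewrite big_nil mrk0.
have [connS | disconn] := boolP (minor_connected S set0).
  exists [:: S]; rewrite /= connS big_seq1; split=> // X sX.
  by rewrite big_seq1 (setIidPl sX).
have [A ltAS [A0 leA]] : exists2 A : {set E}, A \proper S & A != set0 /\ r A + r (S :\: A) <= r S.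
  move: disconn; rewrite /minor_connected S0 /= negb_forall => /existsP[A].
  rewrite negb_imply -leqNgt !setU0 mrk0 addn0 => /andP[/andP[ltAS A0] leA].
  by exists A.
have sAS := proper_sub ltAS; set B := S :\: A in leA.
have DS : A :|: B = S by rewrite -{1}(setIidPr sAS) setID.
have AB0 : A :&: B = set0 by rewrite setIDA setIC -setIDA setDv setI0.
have [|ssA [connA disA DA rA]] := IHk A; first exact: leq_trans (proper_card ltAS) _.
have [|ssB [connB disB DB rB]] := IHk B.
  apply: leq_trans le_S_k; apply: proper_card; rewrite properEneq subsetDl andbT.
  apply: contraNneq A0 => BS; rewrite -subset0 -AB0 subsetI subxx BS //.
exists (ssA ++ ssB); split.
- by rewrite all_cat connA.
- rewrite pairwise_cat disA disB !andbT; apply/allrelP => X Y ssA_X ssB_Y.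
  rewrite -subset0 -AB0 -DA -DB setISS //.
    by rewrite (big_rem X) //= subsetUl.
  by rewrite (big_rem Y) //= subsetUl.
- by rewrite big_cat /= DA DB.
move=> X sX; rewrite big_cat /= (@separator_rank A B) ?DS // rA ?subsetIr // rB ?subsetIr //.
congr (_ + _); apply: eq_big_seq => Y ssY; rewrite -setIA; congr (r (_ :&: _)); apply/setIidPr.
  by rewrite -DA (big_rem Y) //= subsetUl.
by rewrite -DB (big_rem Y) //= subsetUl.
Qed.

(** * Direct sums *)

Definition matroid_sum (I : finType) (E_ : I -> {set E}) : Prop :=
  [/\ forall i j, i != j -> E_ i :&: E_ j = set0, \bigcup_i E_ i = [set: E] &
      forall X, r X = \sum_i r (X :&: E_ i)].

Lemma big_disjoint_cover (R : Type) (idx : R) (op : Monoid.com_law idx) (I : finType)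
    (E_ : I -> {set E}) :
    (forall i j, i != j -> E_ i :&: E_ j = set0) -> \bigcup_i E_ i = [set: E] ->
  forall Y F, \big[op/idx]_(x in Y) F x = \big[op/idx]_i \big[op/idx]_(x in Y :&: E_ i) F x.
Proof.
move=> disE covE Y F.
rewrite [RHS](exchange_big_dep (mem Y)) /=; last by move=> i x _; rewrite inE => /andP[].
apply: eq_bigr => x Yx; have /bigcupP[i _ Eix] : x \in \bigcup_i E_ i by rewrite covE inE.
rewrite (big_pred1 i) // => j; rewrite inE Yx /=; apply/idP/eqP => [Ejx|-> //].
apply: contraTeq isT => ne_ji; have /setP/(_ x) := disE j i ne_ji.
by rewrite !inE Ejx Eix.
Qed.

Lemma matroid_sum_card (I : finType) (E_ : I -> {set E}) :
    (forall i j, i != j -> E_ i :&: E_ j = set0) -> \bigcup_i E_ i = [set: E] ->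
  forall Y, #|Y| = \sum_i #|Y :&: E_ i|.
Proof.
move=> disE covE Y; rewrite -sum1_card (big_disjoint_cover _ disE covE).
by apply: eq_bigr => i _; rewrite sum1_card.
Qed.

Lemma matroid_sum_indep (I : finType) (E_ : I -> {set E}) :
    (forall i j, i != j -> E_ i :&: E_ j = set0) -> \bigcup_i E_ i = [set: E] ->
    (forall X, (X \in indep M) = [forall i, X :&: E_ i \in indep M]) ->
  matroid_sum E_.
Proof.
move=> disE covE indE; split=> // X.
have card_sum := matroid_sum_card disE covE.
apply/eqP; rewrite eqn_leq; apply/andP; split.
  have [J MJ [sJX <-]] := mrk_basis X; rewrite card_sum leq_sum // => i _.
  by apply: mrk_max (setSI _ sJX); apply: indep_sub MJ; apply: subsetIl.
have /fin_all_exists2[I_ MI_ I_P] i : exists2 J, J \in indep M &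
    J \subset X :&: E_ i /\ #|J| = r (X :&: E_ i) by apply: mrk_basis.
have IE i : (\bigcup_j I_ j) :&: E_ i = I_ i.
  have sIE j : I_ j \subset E_ j by have [/subset_trans-> //] := I_P j; apply: subsetIr.
  apply/setP => x; rewrite inE; apply/andP/idP => [[/bigcupP[j _ Ijx] Eix]|Iix]; last first.
    by split; [apply/bigcupP; exists i | apply: subsetP Iix].
  have [<- //|ne_ji] := eqVneq j i; have /setP/(_ x) := disE j i ne_ji.
  by rewrite !inE Eix (subsetP (sIE j)).
apply: (@leq_trans #|\bigcup_j I_ j|).
  by rewrite card_sum leq_sum // => i _; rewrite IE; have [_ ->] := I_P i.
apply: mrk_max; first by rewrite indE; apply/forallP => i; rewrite IE.
by apply/bigcupsP => i _; have [/subset_trans-> //] := I_P i; apply: subsetIl.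
Qed.

End Rank.

Lemma val_preimset (E : finType) (A B : {set E}) :
  val @: (val @^-1: B : {set {x : E | x \in A}}) = B :&: A.
Proof.
apply/setP=> z; apply/imsetP/setIP => [[x + ->]|[Bz Az]].
  by rewrite inE => Bx; split=> //; apply: valP.
by exists (Sub z Az); rewrite ?inE.
Qed.

Section RestrictionRank.
Variables (E : finType) (M : matroid E) (A : {set E}) (N : matroid {x : E | x \in A}).
Hypothesis indepN : forall X, (X \in indep N) = (val @: X \in indep M).

Lemma mrk_restriction X : mrk N X = mrk M (val @: X).
Proof.
apply/eqP; rewrite eqn_leq; apply/andP; split.
  have [I NI [sIX <-]] := mrk_basis N X; rewrite -(card_imset _ val_inj).
  by apply: mrk_max; rewrite -?indepN // imsetS.
have [J MJ [sJX <-]] := mrk_basis M (val @: X).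
have DJ : val @: (val @^-1: J : {set {x : E | x \in A}}) = J.
  rewrite val_preimset; apply/setIidPl; apply: subset_trans sJX _.
  by apply/subsetP=> _ /imsetP[x _ ->]; apply: valP.
rewrite -{1}DJ (card_imset _ val_inj) mrk_max ?indepN ?DJ //.
apply/subsetP=> x; rewrite inE => /(subsetP sJX)/imsetP[y Xy].
by move/val_inj->.
Qed.

Lemma mrank_restriction : mrank N = mrk M A.
Proof.
rewrite /mrank mrk_restriction; congr (mrk M _); apply/setP=> x.
apply/imsetP/idP => [[y _ ->]|Ax]; first exact: valP.
by exists (Sub x Ax).
Qed.

Lemma connected_restriction : connected_matroid N <-> minor_connected M A set0.
Proof.
have imT : val @: [set: {x : E | x \in A}] = A.
  apply/setP=> x; apply/imsetP/idP => [[y _ ->]|Ax]; first exact: valP.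
  by exists (Sub x Ax).
rewrite connected_matroid_minor; split=> /minor_connectedP[T0 conn]; apply/minor_connectedP; split.
- by apply: contraNneq T0 => A0; rewrite -(inj_eq (imset_inj val_inj)) imT imset0 A0.
- move=> B sB B0; have DB : val @: (val @^-1: B : {set {x : E | x \in A}}) = B.
    by rewrite val_preimset; apply/setIidPl/proper_sub.
  have DAB : val @: (~: (val @^-1: B) : {set {x : E | x \in A}}) = A :\: B.
    by rewrite -preimsetC val_preimset setIC setDE.
  have := conn (val @^-1: B); rewrite !setU0 !mrk0 setTD !mrk_restriction DB DAB imT; apply.
    rewrite properT; apply: contraNneq (proper_subn sB) => BT.
    by rewrite -DB BT imT.
  by apply: contraNneq B0 => B0; rewrite -DB B0 imset0.
- by apply: contraNneq T0 => T0; rewrite -imT T0 imset0.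
move=> B sB B0; have := conn (val @: B); rewrite !setU0 !mrk0 !mrk_restriction imT.
have -> : val @: ([set: {x : E | x \in A}] :\: B) = A :\: val @: B.
  apply/setP=> x; apply/imsetP/setDP => [[y]|[Ax B'x]].
    rewrite !inE andbT => B'y ->; split; first exact: valP.
    by rewrite mem_imset //; apply: val_inj.
  exists (Sub x Ax) => //; rewrite !inE andbT; apply: contra B'x => Bx.
  by apply/imsetP; exists (Sub x Ax).
apply; last by rewrite -(inj_eq (imset_inj val_inj)) imset0 in B0.
have: val @: B \proper val @: [set: {x : E | x \in A}]; last by rewrite imT.
rewrite properEneq imsetS ?subsetT // andbT (inj_eq (imset_inj val_inj)).
by apply: contraTneq sB => ->; rewrite properE subxx.
Qed.

End RestrictionRank.

Section Sums.
Variables (E : finType) (M : matroid E).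

Lemma restriction_subproof (A : {set E})
    (ind := [set X : {set {x : E | x \in A}} | val @: X \in indep M]) :
  [/\ set0 \in ind, forall X Y : {set _}, X \subset Y -> Y \in ind -> X \in ind &
     forall X Y, X \in ind -> Y \in ind -> #|X| < #|Y| ->
       exists2 x, x \in Y :\: X & x |: X \in ind].
Proof.
split.
- by rewrite inE imset0 indep0.
- by move=> X Y sXY; rewrite !inE; apply: indep_sub; apply: imsetS.
move=> X Y; rewrite !inE => MX MY lt_XY.
have [|_ /setDP[/imsetP[x Yx ->] X'x] MxX] := indep_aug MX MY.
  by rewrite !(card_imset _ val_inj).
exists x; first by rewrite inE Yx andbT; apply: contra X'x; apply: imset_f.
by rewrite inE imsetU1.
Qed.

Definition restriction (A : {set E}) : matroid {x : E | x \in A} :=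
  let: And3 p0 p1 p2 := restriction_subproof A in Matroid p0 p1 p2.

Lemma restrictionE A X : (X \in indep (restriction A)) = (val @: X \in indep M).
Proof. by rewrite /restriction; case: restriction_subproof => p0 p1 p2; rewrite inE. Qed.

(** A subset of one summand meets all the others in the empty set, so that its
    independence in the sum is its independence in that summand. *)
Lemma direct_sum_restriction (I : finType) (E_ : I -> {set E})
    (M_ : forall i, matroid {x : E | x \in E_ i}) : direct_sum M M_ ->
  (forall i X, (X \in indep (M_ i)) = (val @: X \in indep M)) /\ matroid_sum M E_.
Proof.
case=> disE covE indM.
have res i X : (X \in indep (M_ i)) = (val @: X \in indep M).
  have Xi : val @^-1: (val @: X) = X.
    by apply/setP => x; rewrite inE mem_imset //; apply: val_inj.
  rewrite indM; apply/idP/forallP => [MX j | /(_ i)]; last by rewrite Xi.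
  have [<- | ne_ij] := eqVneq i j; first by rewrite Xi.
  suffices -> : val @^-1: (val @: X) = set0 :> {set {x : E | x \in E_ j}} by apply: indep0.
  apply/setP=> x; rewrite !inE; apply/imsetP=> -[y _ Dx].
  by have /setP/(_ (val x)) := disE i j ne_ij; rewrite !inE {1}Dx (valP x) andbT (valP y).
split=> //; apply: matroid_sum_indep => // X; rewrite indM; apply: eq_forallb => i.
by rewrite res val_preimset.
Qed.

Lemma direct_sum2_restriction (E1 E2 : {set E}) (M1 : matroid {x : E | x \in E1})
    (M2 : matroid {x : E | x \in E2}) : direct_sum2 M M1 M2 ->
  [/\ forall X, (X \in indep M1) = (val @: X \in indep M),
      forall X, (X \in indep M2) = (val @: X \in indep M) &
      matroid_sum M (fun b : bool => if b then E1 else E2)].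
Proof.
case=> disE covE indM.
have preim_self (A : {set E}) (X : {set {x : E | x \in A}}) : val @^-1: (val @: X) = X.
  by apply/setP => x; rewrite inE mem_imset //; apply: val_inj.
have preim_other (A B : {set E}) (X : {set {x : E | x \in A}}) : A :&: B = set0 ->
    val @^-1: (val @: X) = set0 :> {set {x : E | x \in B}}.
  move=> AB0; apply/setP=> x; rewrite !inE; apply/imsetP=> -[y _ Dx].
  by have /setP/(_ (val x)) := AB0; rewrite !inE {1}Dx (valP x) andbT (valP y).
have res1 X : (X \in indep M1) = (val @: X \in indep M).
  by rewrite indM preim_self (preim_other E1 E2) // indep0 andbT.
have res2 X : (X \in indep M2) = (val @: X \in indep M).
  by rewrite indM preim_self (preim_other E2 E1) ?indep0 // setIC.
split=> //; apply: matroid_sum_indep.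
- by case=> [] [] //; rewrite setIC.
- by rewrite big_bool.
move=> X; rewrite indM res1 res2 !val_preimset; apply/andP/forallP => [[? ?] []//|XE].
by split; [apply: (XE true) | apply: (XE false)].
Qed.

Lemma connected_decomposition : exists (k : nat) (E_ : 'I_k -> {set E})
    (M_ : forall i, matroid {x : E | x \in E_ i}),
  (forall i, connected_matroid (M_ i)) /\ direct_sum M M_.
Proof.
have [ss [conn disj cov rk]] := connected_components M [set: E].
pose E_ (i : 'I_(size ss)) := nth set0 ss i.
exists (size ss), E_, (fun i => restriction (E_ i)); split.
  move=> i; apply/(connected_restriction (@restrictionE (E_ i))).
  by move/allP: conn; apply; apply: mem_nth.
have big_E (R : Type) idx (op : Monoid.com_law idx) (F : {set E} -> R) :
    \big[op/idx]_i F (E_ i) = \big[op/idx]_(A <- ss) F A.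
  by rewrite (big_nth set0) big_mkord.
have disE i j : i != j -> E_ i :&: E_ j = set0.
  wlog lt_ij : i j / (i < j)%N.
    move=> IH ne_ij; have [lt|lt|/val_inj eq_ij] := ltngtP i j; first exact: IH.
      by rewrite setIC IH // eq_sym.
    by rewrite eq_ij eqxx in ne_ij.
  by move=> _; apply/eqP; move/(pairwiseP set0): disj; apply; rewrite ?inE.
have covE : \bigcup_i E_ i = [set: E] by rewrite (big_E _ _ _ id).
split=> // X; have rX : mrk M X = \sum_i mrk M (X :&: E_ i).
  by rewrite rk ?subsetT // (big_E _ _ _ (fun A => mrk M (X :&: A))).
under eq_forallb do rewrite restrictionE val_preimset.
apply/idP/forallP => [MX i|ind]; first by apply: indep_sub MX; apply: subsetIl.
rewrite indep_mrk rX; apply/eqP.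
rewrite (matroid_sum_card disE covE X); apply: eq_bigr => i _.
by apply/eqP; rewrite -indep_mrk.
Qed.

End Sums.

Local Open Scope ring_scope.

(** * Values of multivariate polynomials *)

Lemma mmap_comp_mpoly (R S : comNzRingType) (f : {rmorphism R -> S}) n k
    (x : 'I_k -> S) (lq : n.-tuple {mpoly R[k]}) (t : {mpoly R[n]}) :
  mmap f x (t \mPo lq) = mmap f (fun i => mmap f x (tnth lq i)) t.
Proof.
rewrite comp_mpolyEX raddf_sum /=; apply: eq_bigr => m _.
rewrite mmapZ comp_mpolyX rmorph_prod /=; congr (_ * _).
by apply: eq_bigr => i _; rewrite rmorphXn.
Qed.

Lemma mmap_mesym (R S : comNzRingType) (f : {rmorphism R -> S}) n
    (x : 'I_n -> S) k : mmap f x (mesym n R k) = (mesym n S k).@[x].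
Proof.
rewrite /mesym !raddf_sum /=; apply: eq_bigr => h _.
rewrite !rmorph_prod /=; apply: eq_bigr => i _.
by rewrite mmapX mmap1U mevalXU.
Qed.

Lemma mmap_msym (R S : comNzRingType) (f : {rmorphism R -> S}) n
    (x : 'I_n -> S) (s : 'S_n) (P : {mpoly R[n]}) :
  mmap f x (msym s P) = mmap f (x \o s) P.
Proof.
rewrite [P]mpolyE (raddf_sum (msym s)) !raddf_sum /=; apply: eq_bigr => m _.
rewrite msymZ !mmapZ msymX !mmapX; congr (_ * _).
rewrite /mmap1 (reindex_inj (@perm_inj _ s)) /=.
by apply: eq_bigr => i _; rewrite mnmE permK.
Qed.

Lemma mmap_map_mpoly (R S T : comNzRingType) (f : {rmorphism R -> S})
    (g : {rmorphism S -> T}) n (x : 'I_n -> T) (P : {mpoly R[n]}) :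
  mmap g x (map_mpoly f P) = mmap (g \o f) x P.
Proof.
rewrite [P]mpolyE (raddf_sum (map_mpoly f)) !raddf_sum /=.
by apply: eq_bigr => m _; rewrite map_mpolyZ map_mpolyX !mmapZ !mmapX.
Qed.

Lemma eq_mmap (R S : nzRingType) n (f g : R -> S) (x y : 'I_n -> S) P :
  f =1 g -> x =1 y -> mmap f x P = mmap g y P.
Proof.
by move=> eq_fg eq_xy; apply: eq_bigr => m _; rewrite eq_fg (mmap1_eq _ eq_xy).
Qed.

Lemma rmorph_mmap (R S T : comNzRingType) (f : {rmorphism R -> S})
    (g : {rmorphism S -> T}) n (x : 'I_n -> S) P :
  g (mmap f x P) = mmap (g \o f) (g \o x) P.
Proof.
rewrite rmorph_sum; apply: eq_bigr => m _; rewrite rmorphM rmorph_prod /=.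
by congr (_ * _); apply: eq_bigr => i _; rewrite rmorphXn.
Qed.

Lemma map_mpoly_inj (R S : nzRingType) n (g : {rmorphism R -> S}) :
  injective g -> injective (@map_mpoly n R S g).
Proof.
move=> g_inj P Q /mpolyP eqPQ; apply/mpolyP => m; apply: g_inj.
by have := eqPQ m; rewrite !mcoeff_map_mpoly.
Qed.

(** * Fields of fractions *)

Lemma tofracX_inj (R : idomainType) : injective (@tofrac R).
Proof. by move=> a b /eqP; rewrite tofrac_eq => /eqP. Qed.

Lemma fraction_repr (R : idomainType) (a : {fraction R}) :
  tofrac (frac (generic_quotient.repr a)).2 * a = tofrac (frac (generic_quotient.repr a)).1.
Proof.
rewrite -{2}[a]reprK; set x := generic_quotient.repr a.
apply/eqP; rewrite -[_ * _]/(FracField.mul _ _) !piE /FracField.equivf.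
rewrite /FracField.mulf !numden_Ratio ?mulf_neq0 ?oner_eq0 ?denom_ratioP //.
by rewrite mulr1 mul1r.
Qed.

Lemma fraction_numden (R : idomainType) (a : {fraction R}) :
  exists2 d : R, d != 0 & exists b, tofrac d * a = tofrac b.
Proof.
exists (frac (generic_quotient.repr a)).2; first exact: denom_ratioP.
by exists (frac (generic_quotient.repr a)).1; apply: fraction_repr.
Qed.

Lemma fraction_lift (R : idomainType) (L : fieldType) (f : {rmorphism R -> L}) :
  injective f -> exists g : {rmorphism {fraction R} -> L}, forall a, g (tofrac a) = f a.
Proof.
move=> f_inj; pose num (a : {fraction R}) := (frac (generic_quotient.repr a)).1.
pose den (a : {fraction R}) := (frac (generic_quotient.repr a)).2.
pose g a := f (num a) / f (den a).
have fP d : d != 0 -> f d != 0 by rewrite -(inj_eq f_inj) rmorph0.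
have gP a d b : d != 0 -> tofrac d * a = tofrac b -> g a = f b / f d.
  move=> d_neq0 Db; have xP := denom_ratioP (generic_quotient.repr a); have Dx := fraction_repr a.
  apply/eqP; rewrite /g eqr_div ?fP // -!rmorphM (inj_eq f_inj).
  rewrite -(inj_eq (@tofracX_inj R)) !rmorphM /= -Dx -Db.
  by rewrite -mulrA mulrC [a * _]mulrC.
have gP' a : exists2 d, d != 0 & exists2 b, tofrac d * a = tofrac b & g a = f b / f d.
  by have [d d_neq0 [b Db]] := fraction_numden a; exists d => //; exists b; last exact: gP.
have g_add : zmod_morphism g.
  move=> a a'; have [d d0 [b Db ->]] := gP' a; have [d' d'0 [b' Db' ->]] := gP' a'.
  rewrite (gP _ (d * d') (b * d' - b' * d)) ?mulf_neq0 //.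
    by rewrite -[in RHS]mulNr addf_div ?fP // rmorphB !rmorphM mulNr.
  rewrite rmorphB !rmorphM /= -Db -Db' mulrBr.
  by rewrite mulrAC; congr (_ - _); rewrite -mulrA mulrC.
have g_mul : monoid_morphism g.
  split; first by rewrite (gP 1 1 1) ?oner_eq0 ?rmorph1 ?mulr1 ?divr1.
  move=> a a'; have [d d0 [b Db ->]] := gP' a; have [d' d'0 [b' Db' ->]] := gP' a'.
  rewrite (gP _ (d * d') (b * b')) ?mulf_neq0 //; first by rewrite !rmorphM mulf_div.
  by rewrite rmorphM /= mulrACA Db Db' rmorphM.
pose gM : {rmorphism {fraction R} -> L} := HB.pack g
  (GRing.isZmodMorphism.Build _ _ g g_add) (GRing.isMonoidMorphism.Build _ _ g g_mul).
exists gM => a; rewrite /= (gP _ 1 a) ?oner_eq0 ?rmorph1 ?mul1r ?divr1 //.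
Qed.

Lemma mpoly_denominator (R : idomainType) n (P : {mpoly {fraction R}[n]}) :
  exists2 d : R, d != 0 & exists Q, map_mpoly (@tofrac R) Q = tofrac d *: P.
Proof.
elim/mpolyind: P => [|a m P _ _ [d d_neq0 [Q DQ]]].
  by exists 1; rewrite ?oner_eq0 //; exists 0; rewrite rmorph0 scaler0.
have [e e_neq0 [b Db]] := fraction_numden a.
exists (d * e); first exact: mulf_neq0.
exists ((d * b) *: 'X_[m] + e *: Q).
rewrite rmorphD /= !map_mpolyZ map_mpolyX DQ scalerDr !scalerA rmorphM /= -Db.
by rewrite !mulrA rmorphM [_ e * _]mulrC.
Qed.

(** * Conjugate relations between roots *)

(** A symmetric polynomial in the roots is a polynomial in the elementary
    symmetric functions, which are the coefficients of the polynomial divided by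
    its leading coefficient [f c]; the power of [f c] clears these
    denominators. The value [r] lies in [R] and does not depend on [f]. *)
Lemma symmetric_value (R : comNzRingType) n (N : {mpoly R[n]}) c (p : {poly R}) :
  N \is symmetric ->
  exists D r, forall (S : idomainType) (f : {rmorphism R -> S}) (x : 'I_n -> S),
    map_poly f p = f c *: \prod_i ('X - (x i)%:P) ->
    f c ^+ D * mmap f x N = f r.
Proof.
case/sym_fundamental=> t [<- _]; exists (msize t).
exists (\sum_(m <- msupp t) t@_m * c ^+ (msize t - mdeg m) *
   \prod_(i < n) ((-1) ^+ i.+1 * p`_(n - i.+1)) ^+ m i).
move=> S f x Dp; rewrite mmap_comp_mpoly rmorph_sum mulr_sumr /=.
rewrite big_seq [RHS]big_seq; apply: eq_bigr => m /msize_mdeg_lt lt_m.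
rewrite !rmorphM rmorphXn rmorph_prod /= mulrCA -!mulrA; congr (_ * _).
rewrite -{1}(subnK (ltnW lt_m)) exprD -mulrA; congr (_ * _).
rewrite mdegE -prodrXr -big_split /=; apply: eq_bigr => i _.
rewrite -exprMn tnth_mktuple mmap_mesym rmorphXn rmorphM rmorphXn rmorphN1.
rewrite -coef_map Dp coefZ; congr (_ ^+ _).
have Dx: \prod_(z <- [tuple x i | i < n]) ('X - z%:P) = \prod_i ('X - (x i)%:P).
  by rewrite big_tuple; apply: eq_bigr => j _; rewrite tnth_mktuple.
have := mroots_coeff [tuple x i | i < n] (inord i.+1).
rewrite inordK ?ltnS // Dx => ->.
rewrite mulrCA signrMK; congr (_ * _).
by apply: meval_eq => j; rewrite tnth_mktuple.
Qed.

(** The product of all conjugates of a relation [P] under permutations of the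
    variables is symmetric, so its value comes from an element of [R], which
    vanishes because [f] is injective. Hence the product also vanishes at the
    roots in [S'], where one of its factors must be zero. In the applications
    [g] is an embedding or a specialization. *)
Lemma conjugate_relation (R : comNzRingType) (S S' : idomainType)
    (f : {rmorphism R -> S}) (g : {rmorphism R -> S'}) n (x : 'I_n -> S)
    (y : 'I_n -> S') c (p : {poly R}) (P : {mpoly R[n]}) :
    injective f -> g c != 0 ->
    map_poly f p = f c *: \prod_i ('X - (x i)%:P) ->
    map_poly g p = g c *: \prod_i ('X - (y i)%:P) ->
  mmap f x P = 0 -> exists s : 'S_n, mmap g (y \o s) P = 0.
Proof.
move=> f_inj gc_neq0 fp gp Px0; pose N := \prod_(s : 'S_n) msym s P.
have symN : N \is symmetric.
  apply/issymP => s; rewrite rmorph_prod [RHS](reindex_inj (mulIg s)) /=.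
  by apply: eq_bigr => t _; rewrite msymMm.
have [D [r Dr]] := symmetric_value c p symN.
have r0 : r = 0.
  apply: f_inj; rewrite -(Dr S f x fp) rmorph0 rmorph_prod /=.
  by rewrite (bigD1 (1%g : 'S_n)) //= msym1m Px0 mul0r mulr0.
have /eqP := Dr S' g y gp; rewrite r0 rmorph0 mulf_eq0 expf_eq0.
rewrite (negPf gc_neq0) andbF /= rmorph_prod /= => /prodf_eq0[s _ /eqP].
by rewrite mmap_msym; exists s.
Qed.

(** * Polynomials whose Galois group is the symmetric group *)

Lemma roots_tuple (F L : fieldType) (f : {rmorphism F -> L}) (p : {poly F}) zs :
  map_poly f p %= \prod_(z <- zs) ('X - z%:P) ->
  map_poly f p = f (lead_coef p) *: \prod_(i < size zs) ('X - (zs`_i)%:P).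
Proof.
move=> Dp; rewrite -(big_mkord xpredT (fun i => 'X - (zs`_i)%:P)).
rewrite -(big_nth 0 xpredT (fun z => 'X - z%:P)).
have /eqP := eqp_eq Dp; rewrite (monicP (monic_prod_XsubC _ _ _)) scale1r.
by rewrite lead_coef_map => /eqP.
Qed.

Lemma split_roots (F : fieldType) n (p : {poly F}) : size p = n.+1 ->
  exists (L : fieldType) (f : {rmorphism F -> L}) (x : 'I_n -> L),
    map_poly f p = f (lead_coef p) *: \prod_i ('X - (x i)%:P).
Proof.
move=> sz_p; have p_neq0: p != 0 by rewrite -size_poly_gt0 sz_p.
have [L [zs Dp]] := exists_splits p_neq0.
have sz_zs : size zs = n.
  have /eqP := eqp_size Dp.
  by rewrite size_map_poly sz_p size_prod_XsubC => /eqP[].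
exists L, (in_alg L), (fun i => zs`_i); rewrite -sz_zs.
exact: roots_tuple Dp.
Qed.

(** Modulo the relations that express the coefficients of a polynomial by its
    roots, the [i]-th root has degree at most [n - i] over the previous ones;
    hence every polynomial expression in the roots is a combination of the [n`!]
    monomials allowed here. *)
Definition reduced (R : nzRingType) n (P : {mpoly R[n]}) :=
  forall m, P@_m != 0 -> forall i : 'I_n, (m i < n - i)%N.

Definition generic (R : nzRingType) (L : comNzRingType) (f : R -> L) n (x : 'I_n -> L) :=
  injective x /\ forall P : {mpoly R[n]}, reduced P -> mmap f x P = 0 -> P = 0.

(** Over a field, this says that [p] is separable and that its splitting field
    has degree [n`!], in other words that its Galois group is the symmetric
    group. As all fields that contain the roots are considered, the roots may be
    listed in any order. The coefficients are allowed to form a domain so that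
    [R] may be a polynomial ring. *)
Definition full (R : idomainType) n (p : {poly R}) :=
  size p = n.+1 /\
  forall (L : fieldType) (f : {rmorphism R -> L}) (x : 'I_n -> L),
    injective f -> map_poly f p = f (lead_coef p) *: \prod_i ('X - (x i)%:P) ->
  generic f x.

Lemma domain_split_roots (R : idomainType) n (p : {poly R}) : size p = n.+1 ->
  exists (L : fieldType) (f : {rmorphism R -> L}) (x : 'I_n -> L), injective f /\
    map_poly f p = f (lead_coef p) *: \prod_i ('X - (x i)%:P).
Proof.
move=> sz_p; have inj_tofrac := @tofracX_inj R.
have [|L [f [x Dp]]] := @split_roots _ n (map_poly (@tofrac R) p).
  by rewrite size_map_inj_poly ?rmorph0.
exists L, (f \o @tofrac R), x; split; first exact: inj_comp (fmorph_inj f) _.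
by rewrite map_poly_comp Dp lead_coef_map_inj ?rmorph0.
Qed.

(** The transfer of [full] along [g]: a relation between the roots of [p] is
    sent by [g] to a relation that holds, after a permutation, between the roots
    of the image of [p]. Applied to [X_i - X_j], the same argument shows that
    the roots of [p] are distinct. *)
Lemma full_relation (R R' : idomainType) (g : {rmorphism R -> R'}) n c (p : {poly R}) :
    full n (map_poly g p) -> g c = lead_coef (map_poly g p) ->
  forall (L : fieldType) (f : {rmorphism R -> L}) (x : 'I_n -> L), injective f ->
    map_poly f p = f c *: \prod_i ('X - (x i)%:P) ->
  injective x /\
  forall P, reduced P -> mmap f x P = 0 -> map_mpoly g P = 0.
Proof.
move=> [sz_p full_p] gc L f x f_inj Dx.
have [Om [h [y [h_inj Dy]]]] := domain_split_roots sz_p.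
have gen_y (s : 'S_n) : generic h (y \o s).
  apply: full_p => //; rewrite Dy; congr (_ *: _).
  exact: (reindex_inj (@perm_inj _ s)).
have conj P : mmap f x P = 0 -> exists s : 'S_n, mmap h (y \o s) (map_mpoly g P) = 0.
  have hc_neq0 : (h \o g) c != 0.
    by rewrite /= gc -(rmorph0 h) (inj_eq h_inj) lead_coef_eq0 -size_poly_gt0 sz_p.
  have Dhy : map_poly (h \o g) p = (h \o g) c *: \prod_i ('X - (y i)%:P).
    by rewrite map_poly_comp Dy -gc.
  case/(conjugate_relation f_inj hc_neq0 Dx Dhy) => s.
  by rewrite -mmap_map_mpoly; exists s.
split=> [i j eq_ij | P redP /conj[s]].
  have [|s] := conj ('X_i - 'X_j); first by rewrite mmapB !mmapX !mmap1U eq_ij subrr.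
  rewrite rmorphB /= !map_mpolyX mmapB !mmapX !mmap1U => /eqP.
  by rewrite subr_eq0 => /eqP /(proj1 (gen_y s)).
apply: (proj2 (gen_y s)) => m; rewrite mcoeff_map_mpoly => gPm.
by apply: redP; apply: contraNneq gPm => ->; rewrite raddf0.
Qed.

Lemma full_descent (R R' : idomainType) (g : {rmorphism R -> R'}) n (p : {poly R}) :
  injective g -> full n (map_poly g p) -> full n p.
Proof.
move=> g_inj full_p; split; first by have [] := full_p; rewrite size_map_inj_poly ?rmorph0.
move=> L f x f_inj Dx; have [|x_inj x_rel] := full_relation full_p _ f_inj Dx.
  by rewrite lead_coef_map_inj ?rmorph0.
split=> // P redP /(x_rel P redP) gP0.
by apply: (map_mpoly_inj g_inj); rewrite gP0 rmorph0.
Qed.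

(** Removing the powers of the indeterminate common to all coefficients, which
    terminates since a fixed nonzero coefficient loses degree. *)
Lemma mpoly_divX (R : idomainType) n (P : {mpoly {poly R}[n]}) : P != 0 ->
  exists k Q, P = 'X^k *: Q /\ map_mpoly (horner_eval 0) Q != 0.
Proof.
move=> P_neq0; have: P@_(mlead P) != 0 by rewrite mleadc_eq0.
move: (mlead P) => m; have [k] := ubnP (size P@_m).
elim: k P {P_neq0} => // k IHk P; rewrite ltnS => le_Pk Pm_neq0.
have [P0 | P0_neq0] := eqVneq (map_mpoly (horner_eval 0) P) 0; last first.
  by exists 0, P; rewrite scale1r.
pose Q := map_mpoly (@drop_poly R 1) P.
have DP : P = 'X *: Q.
  apply/mpolyP => l; rewrite mcoeffZ mcoeff_map_mpoly.
  have /mpolyP/(_ l) := P0.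
  rewrite mcoeff_map_mpoly mcoeff0 /= /horner_eval horner_coef0 => Pl0.
  by apply/polyP=> [[|i]]; rewrite coefXM //= coef_drop_poly addn1.
have DPm : P@_m = 'X * Q@_m by rewrite {1}DP mcoeffZ.
have Qm_neq0 : Q@_m != 0 by apply: contraNneq Pm_neq0; rewrite DPm => ->; rewrite mulr0.
have [|//|j [Q' [DQ Q'_neq0]]] := IHk Q.
  by move: le_Pk; rewrite DPm mulrC size_mulX.
by exists j.+1, Q'; rewrite DP DQ scalerA exprS.
Qed.

(** A relation between the roots of [p] may be divided by powers of the
    indeterminate, since they are not zero divisors, until its value at 0 is not
    zero; but this value is a relation for [p0] by [full_relation]. *)
Lemma specialization (R : idomainType) n (p : {poly {poly R}}) (c : {poly R}) :
    let p0 := map_poly (horner_eval 0) p in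
    full n p0 -> c.[0] = lead_coef p0 ->
  forall (L : fieldType) (f : {rmorphism {poly R} -> L}) (x : 'I_n -> L), injective f ->
    map_poly f p = f c *: \prod_i ('X - (x i)%:P) ->
  generic f x.
Proof.
move=> p0 full_p c0 L f x f_inj Dx.
have [x_inj x_rel] := full_relation full_p c0 f_inj Dx; split=> // P redP Px0.
apply/eqP/negPn/negP => /mpoly_divX[k [Q [DP /eqP[]]]]; apply: x_rel.
  move=> m Qm; apply: redP; rewrite DP mcoeffZ mulf_neq0 ?expf_neq0 ?polyX_eq0 //.
move/eqP: Px0; rewrite DP mmapZ mulf_eq0 -(rmorph0 f) (inj_eq f_inj).
by rewrite expf_eq0 polyX_eq0 andbF /= rmorph0 => /eqP.
Qed.

Lemma full_specialization (R : idomainType) n (p : {poly {poly R}}) :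
    size p = n.+1 -> full n (map_poly (horner_eval 0) p) ->
    (lead_coef p).[0] = lead_coef (map_poly (horner_eval 0) p) -> full n p.
Proof.
move=> sz_p full_p c0; split=> // L f x f_inj.
exact: specialization full_p c0 L f x f_inj.
Qed.

Lemma full_fraction (R : idomainType) n (p : {poly R}) :
  full n p -> full n (map_poly (@tofrac R) p).
Proof.
have tofrac_inj := @tofracX_inj R.
move=> [sz_p full_p]; split; first by rewrite size_map_inj_poly.
move=> L f x f_inj; rewrite -map_poly_comp lead_coef_map_inj ?rmorph0 // => Dx.
have [|x_inj x_rel] := full_p L (f \o @tofrac R) x (inj_comp f_inj tofrac_inj).
  by rewrite Dx.
split=> // P redP Px0; have [d d_neq0 [Q DQ]] := mpoly_denominator P.
suffices Q0 : Q = 0.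
  apply/eqP; move/eqP: DQ; rewrite Q0 rmorph0 eq_sym.
  by rewrite scaler_eq0 tofrac_eq0 (negPf d_neq0).
apply: x_rel; last by rewrite -mmap_map_mpoly DQ mmapZ Px0 mulr0.
move=> m Qm; apply: redP; move/mpolyP/(_ m)/eqP: DQ.
rewrite mcoeff_map_mpoly mcoeffZ; apply: contraTneq => ->.
by rewrite mulr0 tofrac_eq0.
Qed.

(** In degree at most 1 the only reduced polynomials are the constants. *)
Lemma full_small (R : idomainType) n (p : {poly R}) : (n <= 1)%N -> size p = n.+1 -> full n p.
Proof.
move=> n_le1 sz_p; split=> // L f x f_inj Dx; split=> [i j _ | P redP Px0].
  have eq0 (l : 'I_n) : l = 0%N :> nat.
    by apply/eqP; rewrite -leqn0 -ltnS (leq_trans (ltn_ord l)).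
  by apply: ord_inj; rewrite !eq0.
have DP : P = (P@_0%MM)%:MP.
  apply/mpolyP => m; rewrite mcoeffC; have [->|m_neq0] := eqVneq 0%MM m; first by rewrite mulr1.
  rewrite mulr0; apply/eqP/negPn/negP => /redP lt_m; case/eqP: m_neq0.
  apply/mnmP => i; rewrite mnm0E; apply/esym/eqP; rewrite -leqn0 -ltnS.
  exact: leq_trans (lt_m i) (leq_trans (leq_subr _ _) n_le1).
move: Px0; rewrite DP mmapC -(rmorph0 f) => /f_inj ->.
by rewrite mpolyC0.
Qed.

(** Over the ground field each root of [g] has degree [n], so [g] has no divisor
    of positive degree less than [n], as the gcd would be if it were not
    constant. *)
Lemma coprimep_full (k : fieldType) n (f g : {poly k}) :
  full n g -> (0 < n)%N -> ~~ (g %| f) -> coprimep f g.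
Proof.
move=> [sz_g full_g] n_gt0 g_ndvd_f; set d := gcdp f g.
have g_neq0 : g != 0 by rewrite -size_poly_gt0 sz_g.
have d_neq0 : d != 0 by rewrite gcdp_eq0 negb_and g_neq0 orbT.
have d_dvd_g : d %| g by apply: dvdp_gcdr.
have lt_d : (size d <= n)%N.
  rewrite -ltnS -sz_g ltn_neqAle dvdp_leq // andbT dvdp_size_eqp //.
  by apply: contra g_ndvd_f => /eqp_dvdl <-; apply: dvdp_gcdl.
have [Om [h [y [h_inj Dy]]]] := domain_split_roots sz_g.
rewrite /coprimep -/d eqn_leq size_poly_gt0 d_neq0 andbT leqNgt; apply/negP => d_gt1.
have [i root_i] : exists i, root (map_poly h d) (y i).
  have: map_poly h d %| \prod_(i <- enum 'I_n) ('X - (y i)%:P).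
    have: map_poly h d %| map_poly h g by rewrite dvdp_map.
    by rewrite Dy big_enum dvdpZr // fmorph_eq0 lead_coef_eq0.
  case/dvdp_prod_XsubC => m; set s := mask _ _ => Dd.
  have: size (map_poly h d) = (size s).+1 by rewrite (eqp_size Dd) size_prod_XsubC.
  rewrite size_map_poly; case Ds : s => [|i s'] Dsz; first by rewrite Dsz in d_gt1.
  by exists i; rewrite (eqp_root Dd) Ds big_cons rootM root_XsubC eqxx.
have {full_g} [] : generic h (y \o tperm (Ordinal n_gt0) i).
  apply: full_g => //; rewrite Dy; congr (_ *: _).
  exact: (reindex_inj (@perm_inj _ (tperm (Ordinal n_gt0) i))).
move=> _ free; pose P := \sum_(j < size d) d`_j *: 'X_[U_(Ordinal n_gt0) *+ j] : {mpoly k[n]}.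
have coefP m : P@_m = \sum_(j < size d | (U_(Ordinal n_gt0) *+ j)%MM == m) d`_j.
  rewrite raddf_sum [RHS]big_mkcond; apply: eq_bigr => j _ /=.
  by rewrite mcoeffZ mcoeffX; case: eqP; rewrite ?mulr1 ?mulr0.
case/eqP: d_neq0; apply/polyP => j; rewrite coef0.
have [lt_j|le_j] := ltnP j (size d); last by rewrite nth_default.
have P0 : P = 0; last first.
  have := coefP (U_(Ordinal n_gt0) *+ j)%MM; rewrite P0 mcoeff0.
  rewrite (big_pred1 (Ordinal lt_j)) => [/esym//|l]; apply/eqP/eqP => [/mnmP|-> //].
  by move/(_ (Ordinal n_gt0)); rewrite !mulmnE !mnm1E eqxx !mul1n => eq_lj; apply: ord_inj.
apply: free => [m|]; first rewrite coefP => Pm l.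
  have [l' /eqP<-] : exists l' : 'I_(size d), (U_(Ordinal n_gt0) *+ l')%MM == m.
    apply/existsP; apply: contraNT Pm => /existsPn no_l.
    by rewrite big_pred0 // => l'; apply/negbTE.
  rewrite mulmnE mnm1E; case: eqP => [<-|_]; rewrite ?mul1n ?mul0n ?subn_gt0 //= subn0.
  exact: leq_trans (ltn_ord l') lt_d.
rewrite raddf_sum /=; under eq_bigr do rewrite mmapZ mmapX.
transitivity (map_poly h d).[y i]; last exact/eqP.
rewrite horner_coef size_map_poly.
apply: eq_bigr => l _; rewrite coef_map; congr (_ * _).
rewrite /mmap1 (bigD1 (Ordinal n_gt0)) //= big1 => [|l' ne_l].
  by rewrite mulmnE mnm1E eqxx mul1n tpermL mulr1.
by rewrite mulmnE mnm1E eq_sym (negPf ne_l) mul0n.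
Qed.

(** * The pencil spanned by two coprime polynomials *)

(** The reversed polynomial, for polynomials of degree at most [m]. *)
Definition revp (R : nzRingType) m (f : {poly R}) := \poly_(i < m.+1) f`_(m - i).

Lemma map_revp (R S : nzRingType) (h : {rmorphism R -> S}) m f :
  map_poly h (revp m f) = revp m (map_poly h f).
Proof.
apply/polyP=> i; rewrite coef_map [in LHS]coef_poly [in RHS]coef_poly.
by case: ifP => _; rewrite ?raddf0 // coef_map.
Qed.

Lemma revp_sum (R : comNzRingType) m (f : {poly R}) :
  revp m f = \sum_(l < m.+1) f`_l *: 'X^(m - l).
Proof.
rewrite /revp poly_def (reindex_inj rev_ord_inj) /=.
by apply: eq_bigr => l _; rewrite subSS subKn // -ltnS.
Qed.

Lemma deriv_prod_root (L : fieldType) n (z : 'I_n -> L) j :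
  (\prod_i ('X - (z i)%:P))^`().[z j] = \prod_(i | i != j) (z j - z i).
Proof.
rewrite (bigD1 j) //= derivM derivXsubC mul1r hornerD hornerM hornerXsubC subrr.
by rewrite mul0r addr0 horner_prod; apply: eq_bigr => i _; rewrite hornerXsubC.
Qed.

Lemma horner_revp (L : fieldType) m (f : {poly L}) t : (size f <= m.+1)%N -> t != 0 ->
  (revp m f).[t^-1] * t ^+ m = f.[t].
Proof.
move=> le_f_m t_neq0; rewrite horner_poly (horner_coef_wide _ le_f_m).
rewrite mulr_suml (reindex_inj rev_ord_inj) /=; apply: eq_bigr => i _.
have Dm : t ^+ m = t ^+ (m - i) * t ^+ i by rewrite -exprD subnK // -ltnS.
by rewrite subSS subKn -1?ltnS // exprVn -mulrA Dm mulKf ?expf_neq0.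
Qed.

(** If the sum vanishes, [f] divides its term [c 0 * g ^+ D], hence [c 0], which
    is too small; then divide by [- f]. *)
Lemma coprime_powers_free (k : fieldType) (f g : {poly k}) : coprimep f g ->
  forall D (c : nat -> {poly k}), (forall j, size (c j) < size f)%N ->
  \sum_(j < D) c j * (- f) ^+ j * g ^+ (D - j) = 0 ->
  forall j, (j < D)%N -> c j = 0.
Proof.
move=> co_fg; elim=> // D IHD c lt_cf; rewrite big_ord_recl expr0 mulr1 subn0.
have f_neq0 : f != 0 by rewrite -size_poly_gt0; apply: leq_ltn_trans (lt_cf 0%N).
under eq_bigr do rewrite lift0 subSS exprS mulrCA -mulrA.
rewrite -mulr_sumr => sum0; have c0 : c 0%N = 0.
  apply: contraTeq (lt_cf 0%N) => c0_neq0; rewrite -leqNgt dvdp_leq //.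
  rewrite -(Gauss_dvdpl _ (coprimep_expr D.+1 co_fg)).
  by move/eqP: sum0; rewrite addr_eq0 mulNr opprK => /eqP->; rewrite dvdp_mulr.
move/eqP: sum0; rewrite c0 mul0r add0r mulf_eq0 oppr_eq0 (negPf f_neq0) /= => /eqP sum0.
by case=> // j lt_j_D; apply: (IHD (fun j => c j.+1)).
Qed.

Section Contraction.

Variables (k : fieldType) (n : nat) (f g : {poly k}).
Hypotheses (f_monic : f \is monic) (sz_f : size f = n.+2).
Hypotheses (co_fg : coprimep f g) (full_g : full n g).

Let sz_g : size g = n.+1. Proof. by case: full_g. Qed.

Definition pencil : {poly {poly k}} := map_poly polyC f + 'X *: map_poly polyC g.

Lemma size_pencil : size pencil = n.+2.
Proof.
rewrite size_polyDl size_map_polyC ?sz_f //.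
by rewrite size_scale ?polyX_eq0 // size_map_polyC sz_g.
Qed.

Lemma lead_coef_pencil : lead_coef pencil = 1.
Proof.
rewrite lead_coefDl; first by rewrite lead_coef_map_inj ?(monicP f_monic) //; apply: polyC_inj.
by rewrite size_scale ?polyX_eq0 // !size_map_polyC sz_g sz_f.
Qed.

Variables (L : fieldType) (i : {rmorphism {poly k} -> L}) (x : 'I_n.+1 -> L).
Hypotheses (i_inj : injective i) (Dx : map_poly i pencil = \prod_j ('X - (x j)%:P)).

(* The root t tends to infinity with v = - f(t) / g(t). *)
Let u : {rmorphism k -> L} := i \o polyC.
Let t := x ord0.
Let v := i 'X.
Let fL := map_poly u f.
Let gL := map_poly u g.

Let map_pencil : map_poly i pencil = fL + v *: gL.
Proof. by rewrite rmorphD /= map_polyZ /= -!map_poly_comp. Qed.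

Let ft : fL.[t] = - (v * gL.[t]).
Proof.
apply/eqP; rewrite -addr_eq0 -hornerZ -hornerD -map_pencil Dx.
by rewrite (bigD1 ord0) //= hornerM hornerXsubC subrr mul0r.
Qed.

Let gt_neq0 : gL.[t] != 0.
Proof.
apply/eqP => gt0; have: coprimep fL gL by rewrite coprimep_map.
have rf : root fL t by rewrite rootE ft gt0 mulr0 oppr0.
by move/coprimep_root=> /(_ t rf); rewrite gt0 eqxx.
Qed.

Let i_horner a : i a = (map_poly u a).[v].
Proof.
rewrite -{1}[a]coefK poly_def rmorph_sum horner_coef size_map_poly /=.
by apply: eq_bigr => j _; rewrite -mul_polyC rmorphM rmorphXn coef_map.
Qed.

(** As [v] is a rational function of [t], it would be algebraic if [t] were. *)
Let t_transcendental : ~ algebraicOver u t.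
Proof.
move=> alg_t; have alg_p (a : {poly k}) : algebraicOver u (map_poly u a).[t].
  elim/poly_ind: a => [|a c IHa]; first by rewrite rmorph0 horner0; apply: algebraic0.
  rewrite rmorphD rmorphM /= map_polyX map_polyC hornerMXaddC.
  by apply: algebraic_add (algebraic_id _ _); apply: algebraic_mul.
have [a a_neq0] : algebraicOver u v.
  have -> : v = - (fL.[t] / gL.[t]) by rewrite ft mulNr opprK mulfK.
  by apply: algebraic_opp; apply: algebraic_div; apply: alg_p.
by rewrite rootE -i_horner -(rmorph0 i) (inj_eq i_inj) (negPf a_neq0).
Qed.

Let t_free (a : {poly k}) : (map_poly u a).[t] = 0 -> a = 0.
Proof.
move=> at0; apply/eqP/negPn/negP => a_neq0; case: t_transcendental.
by exists a => //; apply/eqP.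
Qed.

Let t_neq0 : t != 0.
Proof. by apply/eqP=> t0; apply: t_transcendental; rewrite t0; apply: algebraic0. Qed.

(* The indeterminate s of {poly k} is sent to 1 / t. *)
Let w : {rmorphism {poly k} -> L} := horner_eval t^-1 \o map_poly u.

Let w_inj : injective w.
Proof.
apply: raddf_inj => a wa; apply/eqP/negPn/negP => a_neq0; apply: t_transcendental.
by rewrite -[t]invrK; apply: algebraic_inv; exists a => //; apply/eqP.
Qed.

(** Up to the unit [- s gr] of the field, [num] is [f + v * g] written in terms of
    [s = 1 / t], with [fr] and [gr] the values of [s ^ n.+1 * f (1 / s)] and
    [s ^ n * g (1 / s)]. Its quotient [cof] by [1 - s * q] has coefficients in
    [k[s]] and becomes [g] at [s = 0], that is, when [t] is infinite. *)
Let fr := revp n.+1 f.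
Let gr := revp n g.
Let num : {poly {poly k}} := fr *: map_poly polyC g - ('X * gr) *: map_poly polyC f.
Let cof : {poly {poly k}} := \poly_(j < n.+1) \sum_(l < j.+1) num`_l * 'X^(j - l).

Let w_fr : w fr * t ^+ n.+1 = fL.[t].
Proof. by rewrite /w /= /horner_eval map_revp horner_revp // size_map_poly sz_f. Qed.

Let w_gr : w gr * t ^+ n = gL.[t].
Proof. by rewrite /w /= /horner_eval map_revp horner_revp // size_map_poly sz_g. Qed.

Let wX : w 'X = t^-1.
Proof. by rewrite /w /= /horner_eval map_polyX hornerX. Qed.

Let map_w_polyC (a : {poly k}) : map_poly w (map_poly polyC a) = map_poly u a.
Proof.
rewrite -map_poly_comp; apply: eq_map_poly => c.
by rewrite /= /horner_eval map_polyC hornerC.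
Qed.

Let map_num : map_poly w num = - (t^-1 * w gr) *: \prod_j ('X - (x j)%:P).
Proof.
have -> : map_poly w num = w fr *: gL - w ('X * gr) *: fL.
  by rewrite rmorphB /= !map_polyZ !map_w_polyC.
have -> : w fr = - (t^-1 * w gr * v).
  apply: (mulIf (expf_neq0 n.+1 t_neq0)); rewrite w_fr ft -w_gr exprS !mulNr.
  by rewrite [t * _]mulrC mulrA -!mulrA [t^-1 * _]mulrC -!mulrA divff // mulr1 mulrCA.
rewrite -Dx map_pencil rmorphM wX scalerDr scalerA addrC -!scaleNr.
by rewrite mulNr.
Qed.

Let part j := \sum_(l < j.+1) num`_l * 'X^(j - l).

Let partS j : part j.+1 = 'X * part j + num`_j.+1.
Proof.
rewrite /part big_ord_recr /= subnn mulr1 mulr_sumr; congr (_ + _).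
by apply: eq_bigr => l _; rewrite subSn -1?ltnS // exprS mulrCA.
Qed.

Let num_coef j : num`_j = fr * (g`_j)%:P - 'X * gr * (f`_j)%:P.
Proof. by rewrite coefB !coefZ !coef_map. Qed.

(** Up to a power of [s], this is the value of [num] at [q = 1 / s]. *)
Let part_last : part n.+1 = 0.
Proof.
have Dgr : 'X * gr = revp n.+1 g.
  rewrite /gr !revp_sum [RHS]big_ord_recr /= nth_default ?sz_g // scale0r addr0 mulr_sumr.
  by apply: eq_bigr => l _; rewrite subSn -1?ltnS // exprS scalerAr.
rewrite /part; under eq_bigr do rewrite num_coef mulrBl -!mulrA !mul_polyC.
by rewrite big_split /= sumrN -!mulr_sumr -!revp_sum mulrA Dgr mulrC subrr.
Qed.

Let cofE : cof * (1 - 'X *: 'X) = num.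
Proof.
have coef_cof j : cof`_j = if (j < n.+1)%N then part j else 0 by rewrite coef_poly.
apply/polyP=> j; rewrite mulrBr mulr1 -scalerAr coefB coefZ coefMX !coef_cof.
case: j => [|j] /=; first by rewrite mulr0 subr0 /part big_ord1 mulr1.
have [ltjn|] := ltnP j n.
  by rewrite ltnS ltjn ltnS ltnW // partS addrC addKr.
rewrite leq_eqVlt ltnS => /predU1P[<-|lt_n_j].
  by rewrite ltnn ltnSn sub0r; apply/eqP; rewrite eqr_oppLR -addr_eq0 -partS part_last.
rewrite [(j < n)%N]ltnNge (ltnW lt_n_j) ltnS leqNgt lt_n_j /= mulr0 subr0 num_coef.
by rewrite !nth_default ?sz_f ?sz_g ?mulr0 ?subr0 // ltnW.
Qed.

Let map_cof : map_poly w cof = w gr *: \prod_(j < n) ('X - (x (lift ord0 j))%:P).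
Proof.
have tP : 'X - t%:P != 0 :> {poly L} by rewrite polyXsubC_eq0.
apply: (mulIf tP); rewrite -scalerAl mulrC [X in _ = _ *: X]mulrC.
have <- : \prod_j ('X - (x j)%:P) = ('X - t%:P) * \prod_(j < n) ('X - (x (lift ord0 j))%:P).
  by rewrite big_ord_recl.
have: map_poly w cof * (1 - t^-1 *: 'X) = map_poly w num.
  rewrite -cofE rmorphM; congr (_ * _).
  rewrite rmorphB rmorph1 -wX; congr (_ - _).
  by rewrite -[RHS]/(map_poly w ('X *: 'X)) map_polyZ map_polyX.
rewrite map_num => /(congr1 (fun q => (- t) *: q)).
rewrite scalerA mulrNN mulrA divff // mul1r => <-.
rewrite scalerAr scalerBr scalerA mulNr divff // scaleN1r opprK addrC.
by rewrite -mul_polyC mulr1 polyCN mulrC.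
Qed.

Let cof0 : map_poly (horner_eval 0) cof = g.
Proof.
have part0 j : (part j).[0] = (num`_j).[0].
  by case: j => [|j]; rewrite ?partS ?hornerE ?mul0r ?add0r // /part big_ord1 mulr1.
apply/polyP => j; rewrite coef_map coef_poly /= /horner_eval.
case: ltnP => [lt_jn | le_nj]; last by rewrite horner0 nth_default ?sz_g.
rewrite -/(part j) part0 num_coef !hornerE ?mul0r ?subr0.
have -> : fr.[0] = 1 by rewrite horner_coef0 coef_poly subn0 -(monicP f_monic) lead_coefE sz_f.
exact: mul1r.
Qed.

(** The leading coefficient [gr] of [cof] does not vanish at [s = 0]. *)
Let gen_rest : generic w (fun j => x (lift ord0 j)).
Proof.
apply: (specialization _ _ w_inj map_cof); rewrite cof0 //.
by rewrite horner_coef0 coef_poly subn0 lead_coefE sz_g.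
Qed.

(** A polynomial in [v] times the [D]-th power of the denominator of [v]. *)
Let clear_v D (a : {poly k}) : {poly k} := \sum_(j < D) a`_j *: ((- f) ^+ j * g ^+ (D - j)).

Let clearE D (a : {poly k}) : (size a <= D)%N -> (map_poly u (clear_v D a)).[t] = gL.[t] ^+ D * i a.
Proof.
move=> le_a_D; rewrite i_horner [X in _ = _ * X](@horner_coef_wide _ D) ?size_map_poly // mulr_sumr.
rewrite rmorph_sum horner_sum /=; apply: eq_bigr => j _.
rewrite map_polyZ hornerZ rmorphM !rmorphXn rmorphN /= hornerM !horner_exp hornerN.
rewrite -/fL -/gL ft opprK coef_map [in RHS]mulrCA; congr (_ * _).
have -> : gL.[t] ^+ D = gL.[t] ^+ j * gL.[t] ^+ (D - j) by rewrite -exprD subnKC // ltnW.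
by rewrite exprMn -mulrA mulrC.
Qed.

(** The root [t] has degree [n.+1] over [k(v)]: substituting [- f / g] for [v]
    turns a relation of smaller degree into one excluded by
    [coprime_powers_free]. *)
Let irr (C : {poly {poly k}}) : (size C <= n.+1)%N -> (map_poly i C).[t] = 0 -> C = 0.
Proof.
move=> sz_C Ct0; pose D := \max_(j < size C) size (C`_j)%R.
have le_D j : (size (C`_j)%R <= D)%N.
  have [lt_j|le_j] := ltnP j (size C); first exact: (leq_bigmax (Ordinal lt_j)).
  by rewrite nth_default // size_poly0.
pose c l := \poly_(j < n.+1) C`_j`_l.
have c0 l : (l < D)%N -> c l = 0.
  apply: (coprime_powers_free co_fg) => [j|]; first by rewrite sz_f ltnS size_poly.
  transitivity (\sum_(j < n.+1) clear_v D C`_j * 'X^j).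
    rewrite /clear_v; under [RHS]eq_bigr do rewrite mulr_suml.
    rewrite exchange_big /=; apply: eq_bigr => l' _; rewrite /c poly_def !mulr_suml.
    by apply: eq_bigr => j _; rewrite -!scalerAl -mulrA mulrC.
  apply: t_free; rewrite rmorph_sum horner_sum /=.
  transitivity (gL.[t] ^+ D * (map_poly i C).[t]); last by rewrite Ct0 mulr0.
  rewrite [X in _ = _ * X](@horner_coef_wide _ n.+1) ?size_map_inj_poly ?rmorph0 //.
  rewrite mulr_sumr; apply: eq_bigr => j _.
  by rewrite rmorphM /= map_polyXn hornerM hornerXn clearE // coef_map mulrA.
apply/polyP=> j; rewrite coef0; apply/polyP=> l; rewrite coef0.
have [lt_l|le_l] := ltnP l D; last by rewrite nth_default // (leq_trans (le_D j)).
have [lt_j|le_j] := ltnP j n.+1; last by rewrite [C`_j]nth_default ?coef0 // (leq_trans sz_C).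
by move/polyP/(_ j): (c0 l lt_l); rewrite coef_poly lt_j coef0.
Qed.

(** The other roots are distinct by [gen_rest]. If one of them were equal to [t],
    then [t] would be a root of the derivative of the pencil, which has degree at
    most [n] and is not zero because [g] is separable. *)
Let x_inj : injective x.
Proof.
have deriv_g_neq0 : (0 < n)%N -> g^`() != 0.
  move=> n_gt0; apply/eqP => g'0.
  have [Om [h [y [h_inj Dy]]]] := domain_split_roots sz_g.
  have y_inj : injective y by have [_ /(_ Om h y h_inj Dy)[]] := full_g.
  have hc_neq0 : h (lead_coef g) != 0.
    by rewrite -(rmorph0 h) (inj_eq h_inj) lead_coef_eq0 -size_poly_gt0 sz_g.
  have /eqP := congr1 (@deriv _) Dy.
  rewrite deriv_map g'0 rmorph0 derivZ eq_sym scaler_eq0 (negPf hc_neq0) /= => /eqP Dy'.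
  have := deriv_prod_root y (Ordinal n_gt0).
  rewrite Dy' horner0 => /esym/eqP/prodf_eq0[j].
  by rewrite subr_eq0 (inj_eq y_inj) eq_sym => /negPf->.
have t_simple j : x (lift ord0 j) != t.
  apply/eqP => xjt; have n_gt0 : (0 < n)%N := leq_ltn_trans (leq0n j) (ltn_ord j).
  have: pencil^`() = 0.
    apply: irr; first by rewrite -ltnS -size_pencil lt_size_deriv // -size_poly_gt0 size_pencil.
    rewrite -deriv_map Dx deriv_prod_root (bigD1 (lift ord0 j)) //= -/t xjt.
    by rewrite subrr mul0r.
  rewrite /pencil derivD derivZ !deriv_map => /polyP pencil'0.
  case/eqP: (deriv_g_neq0 n_gt0); apply/polyP=> l; have := pencil'0 l.
  rewrite coefD coefZ !coef_map !coef0 /= => /polyP/(_ 1%N).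
  by rewrite coefD coefXM !coefC add0r.
have [rest_inj _] := gen_rest => a b.
case: (unliftP ord0 a) => [a' ->|->]; case: (unliftP ord0 b) => [b' ->|->] //.
- by move/rest_inj->.
- by move/eqP; rewrite (negPf (t_simple a')).
- by move/esym/eqP; rewrite (negPf (t_simple b')).
Qed.

(** Collect the terms of a relation [P] by their monomials in the roots other than
    [t]. Multiplied by suitable powers of [g(t)] and of [1 / t], the coefficients
    lie in [k[1 / t]], so they vanish by [gen_rest]; being polynomials of degree
    at most [n] in [t] over [k[v]], they vanish identically by [irr]. *)
Lemma generic_pencil : generic i x.
Proof.
split; first exact: x_inj.
move=> P redP Px0; pose tail (m : 'X_{1..n.+1}) := [multinom m (lift ord0 j) | j < n].
(* Bounds for the powers of g(t) and of 1 / t. *)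
pose D := \max_(m <- msupp P) size P@_m.
pose B m := clear_v D P@_m * 'X^(m ord0).
pose N := \max_(m <- msupp P) size (B m).
have w_B m : m \in msupp P -> w (revp N (B m)) * t ^+ N = gL.[t] ^+ D * (i P@_m * t ^+ m ord0).
  move=> Pm; rewrite /w /= /horner_eval map_revp horner_revp //; last first.
    by rewrite size_map_poly leqW // (leq_bigmax_seq (F := fun m => size (B m))).
  rewrite /B rmorphM hornerM /= map_polyXn hornerXn clearE ?mulrA //.
  by rewrite (leq_bigmax_seq (F := fun m => size P@_m)).
pose Q := \sum_(m <- msupp P) revp N (B m) *: 'X_[tail m] : {mpoly {poly k}[n]}.
have coefQ mu : Q@_mu = \sum_(m <- msupp P | tail m == mu) revp N (B m).
  rewrite raddf_sum [RHS]big_mkcond /=; apply: eq_bigr => m _.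
  by rewrite mcoeffZ mcoeffX; case: eqP; rewrite ?mulr1 ?mulr0.
have Q0 : Q = 0.
  apply: (proj2 gen_rest) => [mu Qmu j|].
    suffices /hasP[m Pm /eqP <-] : has (fun m => tail m == mu) (msupp P).
      by rewrite mnmE; have := redP m _ (lift ord0 j); rewrite lift0 subSS -mcoeff_msupp; apply.
    by apply: contraNT Qmu => /hasPn no_m; rewrite coefQ big1_seq // => m /andP[Dm /no_m/negP].
  apply: (mulIf (expf_neq0 N t_neq0)); rewrite mul0r.
  transitivity (gL.[t] ^+ D * mmap i x P); last by rewrite Px0 mulr0.
  rewrite /Q raddf_sum mulr_suml [mmap i x P]/mmap mulr_sumr /= big_seq [RHS]big_seq.
  apply: eq_bigr => m Pm; rewrite mmapZ mmapX mulrAC w_B // -!mulrA; congr (_ * (_ * _)).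
  by rewrite /mmap1 big_ord_recl; congr (_ * _); apply: eq_bigr => j _; rewrite mnmE.
pose C mu := \sum_(m <- msupp P | tail m == mu) P@_m *: 'X^(m ord0).
have C0 mu : C mu = 0.
  apply: irr.
    rewrite (leq_trans (size_sum _ _ _)) //; apply/bigmax_leqP_seq => m Pm _.
    rewrite (leq_trans (size_scale_leq _ _)) // size_polyXn.
    by have := redP m _ ord0; rewrite subn0 -mcoeff_msupp; apply.
  apply: (mulfI (expf_neq0 D gt_neq0)); rewrite mulr0.
  have := congr1 (fun a => w a * t ^+ N) (coefQ mu); rewrite Q0 mcoeff0 rmorph0 mul0r => ->.
  rewrite rmorph_sum !raddf_sum /= horner_sum mulr_sumr mulr_suml.
  rewrite big_seq_cond [RHS]big_seq_cond; apply: eq_bigr => m /andP[Pm _].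
  by rewrite w_B // map_polyZ map_polyXn hornerZ hornerXn.
apply/mpolyP=> m; rewrite mcoeff0; have [Pm|/memN_msupp_eq0 //] := boolP (m \in msupp P).
have := congr1 (fun q : {poly {poly k}} => q`_(m ord0)) (C0 (tail m)).
rewrite coef0 coef_sum (big_rem m) //= eqxx coefZ coefXn eqxx mulr1 big1_seq ?addr0 //.
move=> m' /andP[/eqP Dm' rem_m']; rewrite coefZ coefXn.
case: eqP => [Dm0|]; last by rewrite mulr0.
suffices Dm : m = m' by move: rem_m'; rewrite -Dm mem_rem_uniq ?inE ?eqxx // msupp_uniq.
apply/mnmP=> j; case: (unliftP ord0 j) => [j' ->|->] //.
by have /mnmP/(_ j') := Dm'; rewrite !mnmE.
Qed.

End Contraction.

Lemma full_pencil (k : fieldType) n (f g : {poly k}) :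
    f \is monic -> size f = n.+2 -> coprimep f g -> full n g ->
  full n.+1 (pencil f g).
Proof.
move=> f_monic sz_f co_fg full_g; split; first exact: size_pencil full_g.
move=> L i x i_inj; rewrite (lead_coef_pencil f_monic sz_f full_g) rmorph1 scale1r.
exact: generic_pencil full_g L i x i_inj.
Qed.

(** * Algebraic independence *)

Section AlgebraicIndependence.
Variable E : finType.

Definition algindep (K F : comNzRingType) (j : K -> F) (x : E -> F) :=
  forall P : {mpoly K[#|E|]}, mmap j (x \o enum_val) P = 0 -> P = 0.

(** The family [x] restricted to [A]: only monomials in the variables indexed by
    [A] are allowed. *)
Definition algindep_on (A : {set E}) (K F : comNzRingType) (j : K -> F) (x : E -> F) :=
  forall P : {mpoly K[#|E|]},
    (forall m, P@_m != 0 -> forall i, enum_val i \notin A -> m i = 0%N) ->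
  mmap j (x \o enum_val) P = 0 -> P = 0.

Lemma mcoeff_fiber n (K : nzRingType) (P : {mpoly K[n]}) (T : eqType)
    (t : 'X_{1..n} -> T) m mu : t m = mu ->
  (\sum_(l <- msupp P | t l == mu) P@_l *: 'X_[l])@_m = P@_m.
Proof.
move=> Dm; rewrite raddf_sum /= big_mkcond /=.
have [Pm|P'm] := boolP (m \in msupp P).
  rewrite (big_rem m) //= Dm eqxx mcoeffZ mcoeffX eqxx mulr1 big1_seq ?addr0 // => l /= rem_l.
  case: ifP => // _; rewrite mcoeffZ mcoeffX; case: eqP => [Dl|]; last by rewrite mulr0.
  by move: rem_l; rewrite Dl mem_rem_uniq ?inE ?eqxx // msupp_uniq.
rewrite (memN_msupp_eq0 P'm) big1_seq // => l /= Pl; case: ifP => // _.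
rewrite mcoeffZ mcoeffX; case: eqP => [Dl|]; last by rewrite mulr0.
by rewrite Dl (negPf P'm) in Pl.
Qed.

(** A family independent over [K] in [k] stays so when its members in [A] are
    replaced by elements independent over [k]: collect the terms of a relation by
    their part [mA] in the new elements; the coefficients are relations between
    the old elements outside [A]. *)
Lemma algindep_exchange (A : {set E}) (K k F : comNzRingType) (i : {rmorphism K -> k})
    (j : {rmorphism k -> F}) (y : E -> k) (x : E -> F) :
  algindep i y -> algindep_on A j x ->
  algindep (j \o i) (fun e => if e \in A then x e else j (y e)).
Proof.
move=> ind_y ind_x P Pz0; pose z := fun e => if e \in A then x e else j (y e).
pose inA (l : 'I_#|E|) := enum_val l \in A.
pose mA (m : 'X_{1..#|E|}) := [multinom if inA l then m l else 0%N | l < #|E|].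
pose mB (m : 'X_{1..#|E|}) := [multinom if inA l then 0%N else m l | l < #|E|].
pose c m := i P@_m * mmap1 (y \o enum_val) (mB m).
pose Q := \sum_(m <- msupp P) c m *: 'X_[mA m].
have coefQ mu : Q@_mu = \sum_(m <- msupp P | mA m == mu) c m.
  rewrite raddf_sum [RHS]big_mkcond /=; apply: eq_bigr => m _.
  by rewrite mcoeffZ mcoeffX; case: eqP; rewrite ?mulr1 ?mulr0.
have Q0 : Q = 0.
  apply: ind_x => [mu Qmu l A'l|].
    suffices /hasP[m _ /eqP <-] : has (fun m => mA m == mu) (msupp P).
      by rewrite mnmE /inA (negPf A'l).
    apply: contraNT Qmu => /hasPn no_m; rewrite coefQ big1_seq // => m /andP[Dm /no_m].
    by rewrite Dm.
  transitivity (mmap (j \o i) (z \o enum_val) P) => //.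
  rewrite /Q raddf_sum /=; apply: eq_bigr => m _; rewrite mmapZ mmapX rmorphM -mulrA.
  congr (_ * _); rewrite /mmap1 rmorph_prod -big_split /=; apply: eq_bigr => l _.
  by rewrite !mnmE /inA /z rmorphXn /=; case: ifP; rewrite expr0 ?mulr1 ?mul1r.
apply/mpolyP=> m; rewrite mcoeff0 -(mcoeff_fiber P (erefl (mA m))).
set Pm := \sum_(l <- _ | _) _; suffices -> : Pm = 0 by rewrite mcoeff0.
apply: ind_y; have := coefQ (mA m); rewrite Q0 mcoeff0 => Qm.
(* Multiplying by the missing monomial makes this the value of Pm at y. *)
transitivity ((\sum_(l <- msupp P | mA l == mA m) c l) * mmap1 (y \o enum_val) (mA m)).
  rewrite raddf_sum mulr_suml /=; apply: eq_bigr => l /eqP Dl.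
  rewrite mmapZ mmapX -mulrA -Dl -commr_mmap1_M; last by move=> ? ?; apply: mulrC.
  congr (_ * mmap1 _ _); apply/mnmP=> a; rewrite mnmDE !mnmE.
  by case: ifP; rewrite ?addn0.
by rewrite -Qm mul0r.
Qed.

Lemma algindep_indeterminate (e : E) (K : fieldType) (x : E -> {fraction {poly K}}) :
  x e = tofrac 'X -> algindep_on [set e] (@tofrac {poly K} \o polyC) x.
Proof.
move=> xe P suppP Px0.
have suppE m l : P@_m != 0 -> l != enum_rank e -> m l = 0%N.
  move=> Pm ne_l; apply: suppP Pm _ _; rewrite inE; apply: contra ne_l => /eqP <-.
  by rewrite enum_valK.
have := Px0; have -> : mmap (@tofrac {poly K} \o polyC) (x \o enum_val) P =
    tofrac (\sum_(m <- msupp P) P@_m *: 'X^(m (enum_rank e))).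
  rewrite rmorph_sum [LHS]big_seq [RHS]big_seq /=; apply: eq_bigr => m Pm.
  rewrite -mul_polyC rmorphM rmorphXn /= -xe; congr (_ * _).
  rewrite /mmap1 (bigD1 (enum_rank e)) //= enum_rankK big1 ?mulr1 // => l ne_l.
  by rewrite (suppE m) ?expr0 // -mcoeff_msupp.
rewrite -(rmorph0 (@tofrac {poly K})) => /tofracX_inj sum0.
apply/mpolyP=> m; rewrite mcoeff0; have [Pm|/memN_msupp_eq0 //] := boolP (m \in msupp P).
have := congr1 (fun q : {poly K} => q`_(m (enum_rank e))) sum0.
rewrite coef0 coef_sum (big_rem m) //= coefZ coefXn eqxx mulr1 big1_seq ?addr0 //.
move=> m' /= rem_m'; rewrite coefZ coefXn.
case: eqP => [Dm0|]; last by rewrite mulr0.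
suffices Dm : m = m' by move: rem_m'; rewrite -Dm mem_rem_uniq ?inE ?eqxx // msupp_uniq.
have Pm' : m' \in msupp P by apply: mem_rem rem_m'.
apply/mnmP=> l; have [->|ne_l] := eqVneq l (enum_rank e); first by [].
by rewrite !(suppE _ l) -?mcoeff_msupp.
Qed.

End AlgebraicIndependence.

Lemma mmap_var (K : fieldType) (E : finType) (P : {mpoly K[#|E|]}) :
  mmap (@tofrac {mpoly K[#|E|]} \o (@mpolyC #|E| K)) (@var K E \o enum_val) P = tofrac P.
Proof.
rewrite [in RHS](mpolyE P) rmorph_sum; apply: eq_bigr => m _ /=.
rewrite -mul_mpolyC rmorphM /=; congr (_ * _); rewrite mpolyXE_id rmorph_prod.
by apply: eq_bigr => l _; rewrite rmorphXn /= /var enum_valK.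
Qed.

Lemma algindep_var (K : fieldType) (E : finType) :
  algindep (@tofrac {mpoly K[#|E|]} \o (@mpolyC #|E| K)) (@var K E).
Proof.
by move=> P; rewrite mmap_var -(rmorph0 (@tofrac {mpoly K[#|E|]})) => /tofracX_inj.
Qed.

(** * The multivariate Tutte polynomials of minors *)

Section MinorPolynomial.
Variables (E : finType) (M : matroid E).
Implicit Types (A C S : {set E}).
Local Notation r := (mrk M).

(** The multivariate Tutte polynomial of the minor on [S] in which [C] is
    contracted, at the values [v] of the variables. Keeping the ground set [E]
    for all minors avoids renaming the variables. *)
Definition minor_tutte (R : comNzRingType) (v : E -> R) S C : {poly R} :=
  \sum_(A : {set E} | A \subset S) (\prod_(e in A) v e) *: 'X^(r (S :|: C) - r (A :|: C)).

Lemma map_minor_tutte (R R' : comNzRingType) (f : {rmorphism R -> R'}) v S C :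
  map_poly f (minor_tutte v S C) = minor_tutte (f \o v) S C.
Proof.
rewrite rmorph_sum /=; apply: eq_bigr => A _.
by rewrite map_polyZ map_polyXn rmorph_prod.
Qed.

Lemma eq_minor_tutte (R : comNzRingType) (v w : E -> R) S C :
  {in S, v =1 w} -> minor_tutte v S C = minor_tutte w S C.
Proof.
move=> eq_vw; apply: eq_bigr => A sAS; congr (_ *: _); apply: eq_bigr => e Ae.
by rewrite eq_vw // (subsetP sAS).
Qed.

(** The sum over the subsets without [e] belongs to the deletion of [e], as [e] is
    not a coloop, and the sum over those with [e] to the contraction. *)
Lemma minor_tutteD1 (R : comNzRingType) (v : E -> R) S C e :
    minor_connected M S C -> e \in S -> S :\ e != set0 ->
  minor_tutte v S C = minor_tutte v (S :\ e) C + v e *: minor_tutte v (S :\ e) (e |: C).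
Proof.
move=> connS Se S'0; have [_ rS'] := minor_connected_nonloop connS Se S'0.
rewrite /minor_tutte (bigID (fun A : {set E} => e \in A)) /= addrC; congr (_ + _).
  by rewrite rS'; apply: eq_bigl => A; rewrite subsetD1.
rewrite scaler_sumr (reindex_onto (fun A => e |: A) (fun A => A :\ e)) /=; last first.
  by move=> A /andP[_]; apply: setD1K.
apply: eq_big => [A | A].
  rewrite setU11 andbT subUset sub1set Se /= subsetD1; congr (_ && _).
  apply/eqP/idP => [<-|]; first by rewrite !inE eqxx.
  by move=> A'e; apply: setU1K.
move=> /andP[_ /eqP DA]; have A'e : e \notin A by rewrite -DA !inE eqxx.
rewrite big_setU1 //= scalerA; congr (_ *: 'X^(r _ - r _)).
  by rewrite setUCA setUA setD1K.
by rewrite setUCA setUA.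
Qed.

(** Without loops, the empty set is the only subset of rank zero. *)
Lemma minor_tutte_monic (R : comNzRingType) (v : E -> R) S C :
    (forall e, e \in S -> r (e |: C) = (r C).+1) -> (r C < r (S :|: C))%N ->
  size (minor_tutte v S C) = (r (S :|: C) - r C).+1 /\ minor_tutte v S C \is monic.
Proof.
move=> noloop lt_r; set n := (_ - _)%N.
have -> : minor_tutte v S C = 'X^n + \sum_(A : {set E} | (A \subset S) && (A != set0))
    (\prod_(e in A) v e) *: 'X^(r (S :|: C) - r (A :|: C)).
  by rewrite /minor_tutte (bigD1 set0) ?sub0set //= big_set0 scale1r set0U.
set q := \sum_(A | _) _; have le_q : (size q <= n)%N.
  rewrite (leq_trans (size_sum _ _ _)) //; apply/bigmax_leqP => A /andP[sAS /set0Pn[e Ae]].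
  rewrite (leq_trans (size_scale_leq _ _)) // size_polyXn /n.
  have := noloop e (subsetP sAS e Ae).
  have : (r (e |: C) <= r (A :|: C))%N by rewrite mrkS // setSU // sub1set.
  by move: lt_r; clear; lia.
have sz : (size q < size ('X^n : {poly R}))%N by rewrite size_polyXn.
rewrite size_polyDl // size_polyXn; split=> //.
by rewrite monicE lead_coefDl // lead_coefXn.
Qed.

Lemma minor_connected_noloop S C : minor_connected M S C -> (r C < r (S :|: C))%N ->
  forall e, e \in S -> r (e |: C) = (r C).+1.
Proof.
move=> connS lt_r e Se; have [S0|S0] := eqVneq (S :\ e) set0.
  have DS : S = [set e] by rewrite -(setD1K Se) S0 setU0.
  by apply/eqP; rewrite eqn_leq mrkU1 -DS.
by have [] := minor_connected_nonloop connS Se S0.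
Qed.

(** By algebraic independence, a divisibility between these monic polynomials
    holds already for indeterminates over [K]. Give all of them the same value
    ['X] and exchange the two indeterminates: both sides become monic of degree
    [#|S|], the leading term coming from the set [S] alone, so the quotient is 1;
    but the degrees in the original indeterminate differ. *)
Lemma minor_tutte_ndvd (K F : fieldType) (j : {rmorphism K -> F}) (x : E -> F) S C C' :
    algindep j x ->
    (forall e, e \in S -> r (e |: C) = (r C).+1) -> (r C < r (S :|: C))%N ->
    (forall e, e \in S -> r (e |: C') = (r C').+1) -> (r C' < r (S :|: C'))%N ->
    (r (S :|: C) - r C != r (S :|: C') - r C')%N ->
  ~~ (minor_tutte x S C' %| minor_tutte x S C).
Proof.
move=> ind_x nlC ltC nlC' ltC' neq; apply/negP => dvd_x.
pose V e : {mpoly K[#|E|]} := 'X_(enum_rank e).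
pose phi : {rmorphism {mpoly K[#|E|]} -> F} := mmap j (x \o enum_val).
have phiV T D : map_poly phi (minor_tutte V T D) = minor_tutte x T D.
  rewrite map_minor_tutte; apply: eq_minor_tutte => e _.
  by rewrite /= mmapX mmap1U /= enum_rankK.
have phi_inj : injective phi by apply: raddf_inj => P; apply: ind_x.
have [szC' monC'] := minor_tutte_monic V nlC' ltC'.
have [h Dh] : exists h, minor_tutte V S C = h * minor_tutte V S C'.
  exists (Pdiv.CommonRing.rdivp (minor_tutte V S C) (minor_tutte V S C')).
  rewrite {1}(Pdiv.RingMonic.rdivp_eq monC' (minor_tutte V S C)).
  set rho := Pdiv.CommonRing.rmodp _ _; suffices -> : rho = 0 by rewrite addr0.
  have lt_rho : (size rho < size (minor_tutte V S C'))%N.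
    by rewrite Pdiv.CommonRing.ltn_rmodpN0 // monic_neq0.
  have Drho : minor_tutte V S C = Pdiv.CommonRing.rdivp (minor_tutte V S C) (minor_tutte V S C')
      * minor_tutte V S C' + rho := Pdiv.RingMonic.rdivp_eq monC' _.
  have: minor_tutte x S C' %| map_poly phi rho.
    move: dvd_x; rewrite -(phiV S C) Drho rmorphD rmorphM /= phiV dvdp_addr //.
    exact: dvdp_mull.
  apply: contraTeq => rho_neq0; apply: contraL lt_rho => dvd_rho.
  rewrite -leqNgt -(size_map_inj_poly phi_inj) ?rmorph0 // phiV.
  rewrite -(size_map_inj_poly phi_inj (rmorph0 phi) rho) dvdp_leq //.
  by rewrite -size_poly_eq0 size_map_inj_poly ?rmorph0 // size_poly_eq0.
pose psi : {rmorphism {mpoly K[#|E|]} -> {poly K}} := mmap polyC (fun _ => 'X).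
have psiV D : map_poly psi (minor_tutte V S D) = minor_tutte (fun=> 'X) S D.
  by rewrite map_minor_tutte; apply: eq_minor_tutte => e _; rewrite /= mmapX mmap1U.
pose T D : {poly {poly K}} := swapXY (minor_tutte (fun=> 'X) S D).
have DT D : T D = 'X^#|S| + \sum_(A : {set E} | (A \subset S) && (A != S))
    'X^(r (S :|: D) - r (A :|: D)) *: 'X^#|A|.
  have swapA A : swapXY ((\prod_(e in A) 'X) *: 'X^(r (S :|: D) - r (A :|: D))) =
      'X^(r (S :|: D) - r (A :|: D)) *: 'X^#|A| :> {poly {poly K}}.
    rewrite prodr_const -!mul_polyC rmorphM /= swapXY_polyC map_polyXn rmorphXn /= swapXY_X.
    by rewrite -rmorphXn mulrC.
  rewrite /T raddf_sum (bigD1 S) //=; congr (_ + _); last by apply: eq_bigr => A _.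
  by rewrite swapA subnn expr0 scale1r.
have monT D : size (T D) = #|S|.+1 /\ T D \is monic.
  rewrite DT; set q := \sum_(A | _) _; have lt_q : (size q < size ('X^#|S| : {poly {poly K}}))%N.
    rewrite size_polyXn ltnS (leq_trans (size_sum _ _ _)) //.
    apply/bigmax_leqP => A /andP[sAS neAS].
    rewrite (leq_trans (size_scale_leq _ _)) // size_polyXn proper_card //.
    by rewrite properEneq neAS.
  by rewrite size_polyDl // size_polyXn monicE lead_coefDl // lead_coefXn.
have [sz1 mon1] := monT C; have [sz2 mon2] := monT C'.
have DH : T C = swapXY (map_poly psi h) * T C'.
  by rewrite /T -psiV Dh !rmorphM /= psiV.
set H := swapXY _ in DH.
have H_neq0 : H != 0.
  apply: contraTneq mon1 => H0.
  by rewrite DH H0 mul0r monicE lead_coef0 eq_sym oner_eq0.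
have szH : size H = 1%N.
  move: sz1; rewrite DH size_Mmonic // sz2 addnS /= => /eqP.
  by rewrite -[X in _ == X]add1n eqn_add2r => /eqP.
have H1 : H = 1.
  move: mon1; rewrite DH monicE lead_coef_Mmonic // => /eqP lead_H.
  by rewrite [H]size1_polyC ?szH // -[1]/(1%:P) -lead_H lead_coefE szH.
have eqT : minor_tutte (fun=> 'X) S C = minor_tutte (fun=> 'X) S C' :> {poly {poly K}}.
  by apply: (inv_inj swapXYK); rewrite -/(T C) -/(T C') DH H1 mul1r.
have [+ _] := minor_tutte_monic (fun=> 'X : {poly K}) nlC ltC.
rewrite eqT; have [-> _] := minor_tutte_monic (fun=> 'X : {poly K}) nlC' ltC'.
by case=> /eqP; rewrite eq_sym (negPf neq).
Qed.

Lemma size_minor_tutte (R : comNzRingType) (v : E -> R) S C :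
  (size (minor_tutte v S C) <= (r (S :|: C) - r C).+1)%N.
Proof.
rewrite (leq_trans (size_sum _ _ _)) //; apply/bigmax_leqP => A sAS.
by rewrite (leq_trans (size_scale_leq _ _)) // size_polyXn ltnS leq_sub2l // mrkS // subsetUr.
Qed.

(** Induction on [S]. A minor with one element has rank at most 1. Otherwise, for
    [e] in [S], the field for [S] is the field of rational functions in one
    indeterminate, the value of the variable of [e], over the field for the
    deletion or for the contraction of [e]. *)
Lemma minor_full (K : fieldType) S C : minor_connected M S C ->
  exists (F : fieldType) (j : {rmorphism K -> F}) (x : E -> F),
    algindep j x /\ full (r (S :|: C) - r C) (minor_tutte x S C).
Proof.
have [k] := ubnP #|S|; elim: k S C => // k IHk S C; rewrite ltnS => le_S_k connS.
have [e Se] : exists e, e \in S by case/minor_connectedP: connS => /set0Pn.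
have [S'0 | S'0] := eqVneq (S :\ e) set0.
  have DS : S = [set e] by rewrite -(setD1K Se) S'0 setU0.
  exists (Kv K E), (@tofrac {mpoly K[#|E|]} \o (@mpolyC #|E| K)), (@var K E).
  have ind := @algindep_var K E.
  split=> //; set n := (_ - _)%N.
  have n_le1 : (n <= 1)%N by rewrite /n DS leq_subLR addn1 mrkU1.
  apply: full_small => //.
  have -> : minor_tutte (@var K E) S C = 'X^n + (var K e)%:P.
    rewrite /minor_tutte (bigD1 set0) ?sub0set //= big_set0 scale1r set0U; congr (_ + _).
    rewrite (big_pred1 [set e]) => [|A].
      by rewrite big_set1 -DS subnn alg_polyC.
    rewrite DS subset1; have [->|_] := eqVneq A set0; rewrite ?andbF ?andbT ?orbF //.
    by apply/esym/negbTE; rewrite /= eq_sym; apply/set0Pn; exists e; rewrite inE.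
  have [n0|n_gt0] := posnP n; last first.
    by rewrite size_polyDl ?size_polyXn // size_polyC; case: eqP; lia.
  rewrite n0 -polyCD size_polyC; case: eqP => // /eqP.
  rewrite -[1](rmorph1 (@tofrac {mpoly K[#|E|]})) -rmorphD tofrac_eq0 => /eqP/mpolyP/(_ 0%MM)/eqP.
  rewrite mcoeff0 mcoeffD mcoeff1 eqxx mcoeffX.
  by rewrite mnm1_eq0 addr0 oner_eq0.
have [re rS'] := minor_connected_nonloop connS Se S'0.
have lt_r : (r C < r (S :|: C))%N by rewrite -re mrkS // setSU // sub1set.
have nl := minor_connected_noloop connS lt_r.
have lt_S' : (#|S :\ e| < k)%N by move: le_S_k; rewrite (cardsD1 e) Se.
have nl' z : z \in S :\ e -> r (z |: C) = (r C).+1 by case/setD1P=> _; apply: nl.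
have DSC : S :\ e :|: (e |: C) = S :|: C by rewrite setUCA setUA setD1K.
suffices [F' [j' [x' [ind full_x]]]] :
    exists (F' : fieldType) (j' : {rmorphism K -> F'}) (x' : E -> F'),
    algindep j' x' /\ full (r (S :|: C) - r C)
      (pencil (minor_tutte x' (S :\ e) C) (minor_tutte x' (S :\ e) (e |: C))).
  pose x z := if z \in [set e] then tofrac 'X else tofrac (x' z)%:P : {fraction {poly F'}}.
  exists {fraction {poly F'}}, ((@tofrac {poly F'} \o polyC) \o j'), x; split.
    by apply: (algindep_exchange ind); apply: algindep_indeterminate.
  pose y z : {poly F'} := if z == e then 'X else (x' z)%:P.
  have -> : minor_tutte x S C = map_poly (@tofrac {poly F'}) (minor_tutte y S C).
    rewrite map_minor_tutte; apply: eq_minor_tutte => z _.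
    by rewrite /x /y inE /=; case: ifP.
  rewrite (minor_tutteD1 _ connS Se S'0); apply: full_fraction.
  have yE (T D : {set E}) : T \subset S :\ e ->
    minor_tutte y T D = map_poly polyC (minor_tutte x' T D).
    move/subsetP=> sT; rewrite map_minor_tutte; apply: eq_minor_tutte => z /sT.
    by rewrite !inE /y => /andP[/negPf->].
  by rewrite !yE ?subxx // /y eqxx.
have lt_r' : (r C < r (S :\ e :|: C))%N by rewrite rS'.
case: (minor_connected_step connS Se S'0) => connS';
  have [F' [j' [x' [ind]]]] := IHk _ _ lt_S' connS'.
  rewrite rS' => full_x; exists F', j', x'; split=> //.
  have [szf monf] := minor_tutte_monic x' nl' lt_r'; rewrite rS' in szf.
  have lt_g : (size (minor_tutte x' (S :\ e) (e |: C)) < (r (S :|: C) - r C).+1)%N.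
    apply: leq_ltn_trans (size_minor_tutte _ _ _) _; rewrite DSC re.
    by move: lt_r; clear; lia.
  have lt_p : (size ('X *: map_poly polyC (minor_tutte x' (S :\ e) (e |: C))) <
      size (map_poly polyC (minor_tutte x' (S :\ e) C)))%N.
    by rewrite size_scale ?polyX_eq0 // !size_map_polyC szf.
  have ev_pencil : map_poly (horner_eval 0)
      (pencil (minor_tutte x' (S :\ e) C) (minor_tutte x' (S :\ e) (e |: C))) =
    minor_tutte x' (S :\ e) C.
    rewrite rmorphD /= map_polyZ /= {2}/horner_eval hornerX scale0r addr0.
    by rewrite -map_poly_comp map_poly_id // => a _; rewrite /= /horner_eval hornerC.
  apply: full_specialization; rewrite ?ev_pencil //.
    by rewrite size_polyDl // size_map_polyC.
  rewrite lead_coefDl // lead_coef_map_inj ?rmorph0 //; last exact: polyC_inj.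
  by rewrite (monicP monf) hornerC.
have [szf monf] := minor_tutte_monic x' nl' lt_r'; rewrite rS' in szf.
have Dn : (r (S :|: C) - r C = (r (S :|: C) - (r C).+1).+1)%N by move: lt_r; clear; lia.
rewrite DSC re => full_x; exists F', j', x'; split=> //.
rewrite Dn; apply: full_pencil => //; first by rewrite szf Dn.
have [n0|n_gt0] := posnP (r (S :|: C) - (r C).+1)%N.
  rewrite (eqp_coprimepr _ (_ : _ %= 1)) ?coprimep1 // -size_poly_eq1.
  by have [-> _] := full_x; rewrite n0.
apply: (coprimep_full full_x n_gt0); have lt_r2 : (r (e |: C) < r (S :\ e :|: (e |: C)))%N.
  by rewrite DSC re; move: n_gt0; clear; lia.
apply: (minor_tutte_ndvd ind) => //; last by rewrite DSC rS' re Dn; clear; lia.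
exact: minor_connected_noloop.
Qed.

End MinorPolynomial.

Section Product.
Variables (E : finType) (M : matroid E) (I : finType) (E_ : I -> {set E}).
Hypothesis sumM : matroid_sum M E_.

(** Expand the product: a choice of a subset of each [E_ i] is a subset of [E]. *)
Lemma tutte_prod (K : fieldType) :
  tutte K M = \prod_i minor_tutte M (@var K E) (E_ i) set0.
Proof.
have [disE covE rkE] := sumM.
have part A : \bigcup_i (A :&: E_ i) = A by rewrite -big_distrr /= covE setIT.
have partI (f : {ffun I -> {set E}}) : (forall i, f i \subset E_ i) ->
    forall i, (\bigcup_j f j) :&: E_ i = f i.
  move=> sfE i; apply/setP => x; rewrite inE; apply/andP/idP => [[/bigcupP[j _ fjx] Eix]|fix_].
    have [<- //|ne_ji] := eqVneq j i; have /setP/(_ x) := disE j i ne_ji.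
    by rewrite !inE Eix (subsetP (sfE j)).
  by split; [apply/bigcupP; exists i | apply: subsetP fix_].
rewrite /minor_tutte bigA_distr_big_dep /=.
rewrite (reindex_onto (fun A : {set E} => [ffun i => A :&: E_ i])
  (fun f : {ffun I -> {set E}} => \bigcup_i f i)) /=; last first.
  by move=> f /familyP sf; apply/ffunP=> i; rewrite ffunE partI.
rewrite /tutte; apply: eq_big => [A | A _].
  have -> : [ffun i => A :&: E_ i] \in family (fun i (B : {set E}) => B \subset E_ i).
    by apply/familyP => i; rewrite ffunE; apply: subsetIr.
  by under eq_bigr do rewrite ffunE; rewrite part eqxx.
rewrite scaler_prod; congr (_ *: _).
  rewrite (big_disjoint_cover _ disE covE); apply: eq_bigr => i _.
  by rewrite ffunE.
rewrite prodrXr; congr ('X^_); rewrite /mrank (rkE [set: E]) (rkE A) -sumnB => [|i _].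
  by apply: eq_bigr => i _; rewrite ffunE !setU0 setTI.
by rewrite mrkS // setSI // subsetT.
Qed.

End Product.

(** * Embeddings of splitting fields *)

(** Otherwise each permutation [s] is refuted by some relation [P s]. Taking
    them as the coefficients of the distinct powers of a new indeterminate gives
    a single relation over [{poly F}], to which [conjugate_relation] applies: all
    its coefficients vanish for some [s], which contradicts the choice of
    [P s]. *)
Lemma conjugate_tuple (F L Om : fieldType) (f : {rmorphism F -> L})
    (g : {rmorphism F -> Om}) n (x : 'I_n -> L) (y : 'I_n -> Om) c (p : {poly F}) :
    c != 0 -> map_poly f p = f c *: \prod_i ('X - (x i)%:P) ->
    map_poly g p = g c *: \prod_i ('X - (y i)%:P) ->
  exists s : 'S_n, forall P, mmap f x P = 0 -> mmap g (y \o s) P = 0.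
Proof.
move=> c_neq0 Dx Dy; apply: NNPP => no_s.
have {no_s} Ps (s : 'S_n) : exists P, (mmap f x P == 0) && (mmap g (y \o s) P != 0).
  apply: NNPP => no_P; apply: no_s; exists s => P Px; apply/eqP/negPn/negP=> Py.
  by apply: no_P; exists P; rewrite Px eqxx.
pose P (s : 'S_n) : {mpoly F[n]} := xchoose (Ps s).
have Px (s : 'S_n) : mmap f x (P s) = 0 by apply/eqP; case/andP: (xchooseP (Ps s)).
have Py (s : 'S_n) : mmap g (y \o s) (P s) != 0 by case/andP: (xchooseP (Ps s)).
pose U := \sum_(s : 'S_n) 'X^(enum_rank s) *: map_mpoly polyC (P s).
have polyE (K : fieldType) (h : {rmorphism F -> K}) (z : 'I_n -> K) :
    mmap (map_poly h) (polyC \o z) U =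
      \sum_(s : 'S_n) 'X^(enum_rank s) * (mmap h z (P s))%:P.
  rewrite raddf_sum /=; apply: eq_bigr => s _; rewrite mmapZ /= map_polyXn.
  rewrite mmap_map_mpoly rmorph_mmap /=; congr (_ * _).
  by apply: eq_mmap => // a; rewrite /= map_polyC.
have polyD (K : fieldType) (h : {rmorphism F -> K}) (z : 'I_n -> K) :
    map_poly h p = h c *: \prod_i ('X - (z i)%:P) ->
  map_poly (map_poly h) (map_poly polyC p) =
    map_poly h c%:P *: \prod_i ('X - ((polyC \o z) i)%:P).
  move=> Dz; rewrite -map_poly_comp (eq_map_poly (g := polyC \o h)); last first.
    by move=> a; rewrite /= map_polyC.
  rewrite map_poly_comp Dz map_polyC map_polyZ rmorph_prod /=; congr (_ *: _).
  by apply: eq_bigr => i _; rewrite rmorphB /= map_polyX map_polyC.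
have [||s] := conjugate_relation (map_poly_inj f) _ (polyD _ _ _ Dx) (polyD _ _ _ Dy) (P := U).
- by rewrite map_poly_eq0 polyC_eq0.
- by rewrite polyE big1 // => s _; rewrite Px mulr0.
rewrite (eq_mmap (g := map_poly g) (y := polyC \o (y \o s))) // polyE.
move/(congr1 (fun q : {poly Om} => q`_(enum_rank s))); rewrite coef0 coef_sum.
rewrite (bigD1 s) //= big1 ?addr0 => [|t ne_ts].
  by rewrite coefMC coefXn eqxx mul1r => /eqP; rewrite (negPf (Py s)).
rewrite coefMC coefXn (inj_eq val_inj) (inj_eq enum_rank_inj) eq_sym (negPf ne_ts).
by rewrite mul0r.
Qed.

Lemma adjoin_mmap (F : fieldType) (L : fieldExtType F) n (x : 'I_n -> L) ts :
    {subset ts <= codom x} -> forall z, z \in <<1 & ts>>%VS ->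
  exists P, z = mmap (in_alg L) x P.
Proof.
elim/last_ind: ts => [|ts t IHts] sub_ts z.
  by rewrite Fadjoin_nil => /vlineP[a ->]; exists a%:MP; rewrite mmapC.
rewrite adjoin_rcons => /Fadjoin_polyP[q /polyOverP Kq ->].
have /codomP[i Dt] : t \in codom x by apply: sub_ts; rewrite mem_rcons mem_head.
have /fin_all_exists[Q DQ] (j : 'I_(size q)) : exists P, q`_j = mmap (in_alg L) x P.
  by apply: IHts => // u ts_u; apply: sub_ts; rewrite mem_rcons inE ts_u orbT.
exists (\sum_j Q j * 'X_i ^+ j); rewrite horner_coef rmorph_sum.
by apply: eq_bigr => j _; rewrite rmorphM rmorphXn /= mmapX mmap1U DQ Dt.
Qed.

(** Each element of [L] is a polynomial in the roots [zs]; it is sent to the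
    value of the same polynomial at the roots [ws], ordered as in
    [conjugate_tuple] so that this does not depend on the polynomial. *)
Lemma splitting_embedding (F : fieldType) (L : fieldExtType F) (Om : fieldType)
    (g : {rmorphism F -> Om}) (p : {poly F}) zs ws :
    p != 0 -> map_poly (in_alg L) p %= \prod_(z <- zs) ('X - z%:P) ->
    <<1 & zs>>%VS = {:L}%VS -> map_poly g p %= \prod_(w <- ws) ('X - w%:P) ->
  exists e : {rmorphism L -> Om}, forall a, e a%:A = g a.
Proof.
move=> p_neq0 /[dup] Dsz /roots_tuple Dzs Dgen /[dup] Dsw /roots_tuple.
have <- : size zs = size ws.
  apply: succn_inj; rewrite -!(size_prod_XsubC _ id) -(eqp_size Dsz) -(eqp_size Dsw).
  by rewrite !size_map_poly.
move=> Dws; have [|s sP] := conjugate_tuple _ Dzs Dws; first by rewrite lead_coef_eq0.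
pose x (i : 'I_(size zs)) : L := zs`_i; set y := (fun _ => _) \o s in sP.
have exP z : exists P, z == mmap (in_alg L) x P.
  have [||P ->] := @adjoin_mmap F L _ x zs _ z; last by exists P.
    by move=> u zs_u; apply/codomP; exists (Ordinal (etrans (index_mem u zs) zs_u));
       rewrite /x nth_index.
  by rewrite Dgen memvf.
pose e z := mmap g y (xchoose (exP z)).
have eP P : e (mmap (in_alg L) x P) = mmap g y P.
  apply/eqP; rewrite -subr_eq0 -rmorphB; apply/eqP/sP; rewrite rmorphB /=.
  by rewrite -(eqP (xchooseP (exP _))) subrr.
have exP' z : exists P, z = mmap (in_alg L) x P by have [P /eqP] := exP z; exists P.
have e_add : zmod_morphism e.
  by move=> u v; have [P ->] := exP' u; have [Q ->] := exP' v; rewrite -rmorphB !eP rmorphB.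
have e_mul : monoid_morphism e.
  split; first by rewrite -(rmorph1 (mmap (in_alg L) x)) eP rmorph1.
  by move=> u v; have [P ->] := exP' u; have [Q ->] := exP' v; rewrite -rmorphM !eP rmorphM.
pose eM : {rmorphism L -> Om} := HB.pack e
  (GRing.isZmodMorphism.Build _ _ e e_add) (GRing.isMonoidMorphism.Build _ _ e e_mul).
by exists eM => a; rewrite -[a%:A]/(in_alg L a) -(mmapC x (in_alg L)) /= eP mmapC.
Qed.

(** * The Galois group of a direct sum *)

Section FieldDimension.
Variables (F : fieldType) (L : fieldExtType F).

Lemma dim_independent (U : {subfield L}) (T : finType) (b : T -> L) :
    (forall c : T -> L, (forall t, c t \in U) -> \sum_t c t * b t = 0 -> forall t, c t = 0) ->
  (#|T| * \dim U <= \dim {:L})%N.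
Proof.
move=> free_b; have b_neq0 t : b t != 0.
  apply/eqP=> bt0; have : (t == t)%:R = 0 :> L.
    apply: (free_b (fun t' => (t' == t)%:R)) => [t'|].
      by case: eqP => _; rewrite ?mem0v ?mem1v.
    by rewrite (bigD1 t) //= bt0 mulr0 big1 ?addr0 // => t' /negPf->; rewrite mul0r.
  by move/eqP; rewrite eqxx oner_eq0.
have dir : directv (\sum_t U * <[b t]>)%VS.
  apply/directv_sum_independent => us Uus sum0 t _.
  have /fin_all_exists2[c Uc Dc] t' : exists2 c, c \in U & us t' = c * b t'.
    have /memv_cosetP[c Uc Dc] := Uus t' isT; exists c => //.
  rewrite Dc (free_b c) ?mul0r // -[RHS]sum0; apply: eq_bigr => t' _.
  by rewrite Dc.
have := dimvS (subvf (\sum_t U * <[b t]>)%VS).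
rewrite (directvP dir) /=; under eq_bigr do rewrite dim_cosetv_unit ?unitfE //.
by rewrite sum_nat_const.
Qed.

Lemma separable_adjoin_seq (K : {subfield L}) ts :
  all (separable_element K) ts -> separable K <<K & ts>>.
Proof.
elim: ts K => [|t ts IHts] K /=.
  rewrite Fadjoin_nil => _; exact: separable_refl.
case/andP=> sepKt sepKts; apply/separableP => u Ku.
have {}Ku : u \in <<<<K; t>> & ts>>%VS by rewrite -adjoin_cons.
apply: (adjoin_separable sepKt); apply: (separableP (IHts _ _)) Ku.
apply/allP => v ts_v; apply: separable_elementS (subv_adjoin K t) _.
exact: (allP sepKts).
Qed.

End FieldDimension.

(** The number of reduced monomials in [n] variables. *)
Lemma card_reduced n : #|{: {dffun forall i : 'I_n, 'I_(n - i)}}| = n`!.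
Proof.
rewrite card_dep_ffun /= foldrE big_map big_enum /= -ffactnn ffact_prod.
by apply: eq_bigr => i _; rewrite card_ord.
Qed.

Lemma algindep_comp (E : finType) (K F F' : fieldType) (j : {rmorphism K -> F})
    (f : {rmorphism F -> F'}) (x : E -> F) :
  algindep j x -> algindep (f \o j) (f \o x).
Proof.
move=> ind_x P; have -> : mmap (f \o j) (f \o x \o enum_val) P = f (mmap j (x \o enum_val) P).
  by rewrite rmorph_mmap.
by rewrite -(rmorph0 f) => /fmorph_inj/ind_x.
Qed.

(** The universal property of a field of rational functions. *)
Definition universal (E : finType) (K F : fieldType) (v : E -> F) :=
  forall (F' : fieldType) (j : {rmorphism K -> F'}) (z : E -> F'), algindep j z ->
  exists b : {rmorphism F -> F'}, forall e, b (v e) = z e.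

Lemma universal_var (K : fieldType) (E : finType) : universal K (@var K E).
Proof.
move=> F' j z ind_z; pose phi : {rmorphism {mpoly K[#|E|]} -> F'} := mmap j (z \o enum_val).
have phi_inj : injective phi by apply: raddf_inj => P; apply: ind_z.
have [b Db] := fraction_lift phi_inj; exists b => e.
by rewrite Db /phi [LHS]mmapX mmap1U /= enum_rankK.
Qed.

(** The ground field is an abstract field [F] with the universal property of
    [Kv K E], so that terms stay small. *)
Section ComponentGroups.
Variables (K : fieldType) (E : finType) (M : matroid E) (I : finType) (E_ : I -> {set E}).
Hypothesis sumM : matroid_sum M E_.
Hypothesis connE : forall i, minor_connected M (E_ i) set0.

Variables (F : fieldType) (h : {rmorphism K -> F}) (v : E -> F).
Hypotheses (ind_v : algindep h v) (univ_v : universal K v).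

Let p i : {poly F} := minor_tutte M v (E_ i) set0.
Variable r : I -> nat.
Hypothesis rE : forall i, r i = mrk M (E_ i).
Let P := \prod_i p i.
Hypothesis P_neq0 : P != 0.

(** Let [k0] be a splitting field of the other factors. The variables indexed by
    [E_ i] are sent to elements independent over [k0], provided by [minor_full],
    and the others to themselves; the images of the other factors split already
    over [k0]. *)
Lemma component_full i : exists (F' : fieldType) (b : {rmorphism F -> F'}),
  (exists ws, map_poly b (\prod_(j | j != i) p j) %= \prod_(w <- ws) ('X - w%:P)) /\
  full (r i) (map_poly b (p i)).
Proof.
have [disE _ _] := sumM.
have q_neq0 : \prod_(j | j != i) p j != 0.
  by move: P_neq0; rewrite /P (bigD1 i) //= mulf_eq0 negb_or => /andP[].
have [k0 [zs Dq]] := exists_splits q_neq0; pose c : {rmorphism F -> k0} := in_alg k0.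
have [F' [j [x [ind_x full_x]]]] := minor_full k0 (connE i).
have ind_y := algindep_comp (f := c) ind_v.
pose z e := if e \in E_ i then x e else j ((c \o v) e).
have ind_z : algindep (j \o (c \o h)) z.
  by apply: (algindep_exchange ind_y) => Q _; apply: ind_x.
have [b bvar] := univ_v ind_z; exists F', b; split.
  exists (map j zs); rewrite big_map.
  have eq_p l : l != i -> map_poly b (p l) = map_poly j (map_poly c (p l)).
    move=> ne_li; rewrite /p !map_minor_tutte.
    apply: eq_minor_tutte => e E_l_e; rewrite /= bvar /z.
    suffices /negPf-> : e \notin E_ i by [].
    by apply/negP => E_i_e; have /setP/(_ e) := disE l i ne_li; rewrite !inE E_l_e E_i_e.
  have -> : map_poly b (\prod_(l | l != i) p l) = map_poly j (map_poly c (\prod_(l | l != i) p l)).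
    by rewrite !rmorph_prod; apply: eq_bigr.
  have -> : \prod_(w <- zs) ('X - (j w)%:P) = map_poly j (\prod_(w <- zs) ('X - w%:P)).
    by rewrite rmorph_prod; apply: eq_bigr => w _; rewrite rmorphB /= map_polyX map_polyC.
  by rewrite eqp_map.
move: full_x; rewrite rE /p map_minor_tutte !setU0 mrk0 subn0.
suffices -> : minor_tutte M (b \o v) (E_ i) set0 = minor_tutte M x (E_ i) set0 by [].
by apply: eq_minor_tutte => e E_i_e; rewrite /= bvar /z E_i_e.
Qed.

Variable L : splittingFieldType F.
Hypothesis splitL : splitting_field P L.
Local Notation toL := (in_alg L).

Lemma component_roots i : exists x : 'I_(r i) -> L,
  map_poly toL (p i) = toL (lead_coef (p i)) *: \prod_l ('X - (x l)%:P).
Proof.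
have [zs Dzs _] := splitL.
have: map_poly toL (p i) %| \prod_(z <- zs) ('X - z%:P).
  rewrite -(eqp_dvdr _ Dzs) dvdp_map /P (bigD1 i) //=; exact: dvdp_mulr.
case/dvdp_prod_XsubC => m; set ts := mask m zs => Dts.
have sz_ts : size ts = r i.
  have [F' [b [_ [sz_p _]]]] := component_full i.
  by apply: succn_inj; rewrite -sz_p -(size_prod_XsubC ts id) -(eqp_size Dts) !size_map_poly.
have Dp := roots_tuple Dts; rewrite sz_ts in Dp.
by exists (fun l => ts`_l).
Qed.

Variable x : forall i, 'I_(r i) -> L.
Arguments x : clear implicits.
Hypothesis Dx : forall i,
  map_poly toL (p i) = toL (lead_coef (p i)) *: \prod_l ('X - (x i l)%:P).

Let p_neq0 i : p i != 0.
Proof. by move/prodf_neq0: P_neq0; apply. Qed.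

Let toLp_neq0 i : toL (lead_coef (p i)) != 0.
Proof. by rewrite fmorph_eq0 lead_coef_eq0. Qed.

Let x_inj i : injective (x i).
Proof.
have [F' [b [_ full_p]]] := component_full i.
have [_ /(_ L toL (x i) (fmorph_inj _) (Dx i))[]] := full_descent (fmorph_inj b) full_p.
by [].
Qed.

(* The field U i is generated by the roots of the other factors. *)
Let others i : seq L := [seq x j l | j <- enum (predC1 i), l <- enum 'I_(r j)].
Let U i := <<1 & others i>>%AS.

Let others_root i z : z \in others i -> root (map_poly toL (\prod_(j | j != i) p j)) z.
Proof.
case/allpairsPdep=> j [l [ne_ji _ ->]]; rewrite mem_enum inE in ne_ji.
by rewrite (bigD1 j) //= rmorphM rootM /= Dx rootZ // (bigD1 l) //= rootM root_XsubC eqxx.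
Qed.

Let x_others i j l : j != i -> x j l \in others i.
Proof. by move=> ne_ji; apply/allpairsPdep; exists j, l; rewrite !mem_enum inE. Qed.

(** Embed [L] in a field [Om] that contains the field [F'] of [component_full]. The
    other factors split over [F'], so the coefficients, which lie in [U i], are
    sent to [F'], and the relation contradicts fullness over [F']. *)
Lemma independent_roots i (c : {dffun forall l : 'I_(r i), 'I_(r i - l)} -> L) :
    (forall t, c t \in U i) -> \sum_t c t * (\prod_l x i l ^+ t l) = 0 ->
  forall t, c t = 0.
Proof.
move=> Uc sum0; have [F' [b [[ws Dws] full_p]]] := component_full i.
have bp_neq0 : map_poly b (p i) != 0 by rewrite map_poly_eq0.
have [Om [us Dus]] := exists_splits bp_neq0; pose g : {rmorphism F' -> Om} := in_alg Om.
pose gb : {rmorphism F -> Om} := g \o b.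
have gbE q : map_poly gb q = map_poly g (map_poly b q) by rewrite map_poly_comp.
have prod_map ts : \prod_(w <- map g ts) ('X - w%:P) = map_poly g (\prod_(w <- ts) ('X - w%:P)).
  rewrite big_map rmorph_prod; apply: eq_bigr => w _.
  by rewrite rmorphB /= map_polyX map_polyC.
have Dgw : map_poly gb (\prod_(j | j != i) p j) %= \prod_(w <- map g ws) ('X - w%:P).
  by rewrite gbE prod_map eqp_map.
have [zs Dzs Lzs] := splitL.
have [||e De] := @splitting_embedding F L Om gb P zs (us ++ map g ws) _ Dzs Lzs _ => //.
  rewrite big_cat /= /P (bigD1 i) //= rmorphM.
  apply: (@eqp_trans _ (\prod_(w <- us) ('X - w%:P) * map_poly gb (\prod_(j | j != i) p j))).
    by apply: eqp_mulr; rewrite -[X in X %= _]/(map_poly gb (p i)) gbE.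
  exact: eqp_mull.
have eU u : u \in U i -> exists d, e u = g d.
  case/(@adjoin_mmap F L (size (others i)) (fun l => (others i)`_l)) => [z Uz|Q ->].
    by apply/codomP; exists (Ordinal (etrans (index_mem z _) Uz)); rewrite /= nth_index.
  have /fin_all_exists[w Dw] (l : 'I_(size (others i))) : exists w, e (others i)`_l = g w.
    have: root (map_poly gb (\prod_(j | j != i) p j)) (e (others i)`_l).
      rewrite -(eq_map_poly De) (map_poly_comp e toL) fmorph_root.
      by apply: others_root; apply: mem_nth.
    by rewrite (eqp_root Dgw) root_prod_XsubC => /mapP[w _ ->]; exists w.
  exists (mmap b w Q); rewrite !rmorph_mmap; apply: eq_mmap => [a|l] /=; first exact: De.
  exact: Dw.
have /fin_all_exists[d Dd] t := eU _ (Uc t).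
have [_ /(_ Om g (e \o x i) (fmorph_inj g))[]] := full_p.
  rewrite -gbE lead_coef_map -[g _]/(gb _) -De -(eq_map_poly De) (map_poly_comp e toL) Dx.
  rewrite map_polyZ rmorph_prod; congr (_ *: _); apply: eq_bigr => l _.
  by rewrite /= rmorphB /= map_polyX map_polyC.
move=> _ free; pose mon (t : {dffun forall l : 'I_(r i), 'I_(r i - l)}) : 'X_{1..r i} :=
  [multinom (t l : nat) | l < r i].
have mon_inj : injective mon.
  move=> t t' /mnmP eq_tt'; apply/ffunP => l; apply: ord_inj.
  by have := eq_tt' l; rewrite !mnmE.
pose Q := \sum_t d t *: 'X_[mon t] : {mpoly F'[r i]}.
have coefQ m : Q@_m = \sum_(t | mon t == m) d t.
  rewrite raddf_sum [RHS]big_mkcond; apply: eq_bigr => t _ /=.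
  by rewrite mcoeffZ mcoeffX; case: eqP; rewrite ?mulr1 ?mulr0.
have Q0 : Q = 0.
  apply: free => [m Qm l|].
    have [t /eqP<-] : exists t, mon t == m.
      apply/existsP; apply: contraNT Qm => /existsPn no_t.
      by rewrite coefQ big_pred0 // => t; apply/negbTE.
    by rewrite mnmE.
  rewrite -(rmorph0 e) -sum0 [RHS]rmorph_sum raddf_sum; apply: eq_bigr => t _ /=.
  rewrite mmapZ mmapX rmorphM -Dd rmorph_prod; congr (_ * _).
  by apply: eq_bigr => l _; rewrite mnmE rmorphXn.
move=> t; apply: (fmorph_inj e); rewrite rmorph0 Dd.
have := coefQ (mon t); rewrite Q0 mcoeff0 (big_pred1 t) => [<-|t']; first by rewrite rmorph0.
by rewrite /= (inj_eq mon_inj).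
Qed.

Let L_generated : {:L}%VS = <<1 & [seq x j l | j <- enum I, l <- enum 'I_(r j)]>>%VS.
Proof.
have [zs Dzs Lzs] := splitL; apply/eqP; rewrite eqEsubv subvf andbT -Lzs.
apply/Fadjoin_seqP; split=> [|z zs_z]; first exact: sub1v.
have: root (map_poly toL P) z by rewrite (eqp_root Dzs) root_prod_XsubC.
rewrite /P rmorph_prod rootE horner_prod => /prodf_eq0[i _ /=].
rewrite Dx hornerZ mulf_eq0 (negPf (toLp_neq0 i)) horner_prod => /prodf_eq0[l _].
rewrite hornerXsubC subr_eq0 => /eqP->; apply: seqv_sub_adjoin.
by apply/allpairsPdep; exists i, l; rewrite !mem_enum.
Qed.

Let galL : galois 1 {:L}.
Proof.
rewrite /galois sub1v normalFieldf andbT L_generated; apply: separable_adjoin_seq.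
apply/allP => _ /allpairsPdep[i [l [_ _ ->]]]; apply/separable_elementP.
exists (map_poly toL (p i)); split; first exact: alg_polyOver.
  by rewrite Dx rootZ // (bigD1 l) //= rootM root_XsubC eqxx.
have -> : separable_poly (map_poly toL (p i)) =
    separable_poly (\prod_(l <- enum 'I_(r i)) ('X - (x i l)%:P)).
  by rewrite Dx; apply: eqp_separable; rewrite big_enum eqp_scale.
rewrite -(big_map (x i) xpredT (fun z => 'X - z%:P)) separable_prod_XsubC.
by rewrite (map_inj_uniq (@x_inj i)) enum_uniq.
Qed.

(** The reduced monomials in the roots of the [i]-th factor are independent over
    [U i]. *)
Let card_gal i : ((r i)`! <= #|'Gal({:L} / U i)%g|)%N.
Proof.
rewrite -galois_dim; last by apply: galoisS galL; rewrite sub1v subvf.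
rewrite leq_divRL ?adim_gt0 // -card_reduced.
exact: dim_independent (@independent_roots i).
Qed.

Let gal_root (s : gal_of {:L}) i l : exists l', s (x i l) = x i l'.
Proof.
have: root (map_poly toL (p i)) (s (x i l)).
  have s_hom : kHom 1 {:L} s by apply: k1AHom.
  apply: (kHom_root_id (sub1v _) s_hom) (memvf _) _; first exact: alg_polyOver.
  by rewrite Dx rootZ // (bigD1 l) //= rootM root_XsubC eqxx.
rewrite Dx rootE hornerZ mulf_eq0 (negPf (toLp_neq0 i)) horner_prod => /prodf_eq0[l' _].
by rewrite hornerXsubC subr_eq0 => /eqP; exists l'.
Qed.

Let gal_fun (s : gal_of {:L}) i l : 'I_(r i) := odflt l [pick l' | s (x i l) == x i l'].

Let gal_funE s i l : x i (gal_fun s l) = s (x i l).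
Proof.
rewrite /gal_fun; case: pickP => [l' /eqP // | no_l'].
by have [l' /eqP] := gal_root s l; rewrite no_l'.
Qed.

Let gal_fun_inj s i : injective (@gal_fun s i).
Proof.
move=> l l' /(congr1 (x i)); rewrite !gal_funE => eq_ll'.
exact/(x_inj (i := i))/(lker0P (AEnd_lker0 s)).
Qed.

Let gal_perm (s : gal_of {:L}) : {dffun forall i, 'S_(r i)} :=
  [ffun i => perm (@gal_fun_inj s i)].

Let gal_permE s i l : x i (gal_perm s i l) = s (x i l).
Proof. by rewrite ffunE permE gal_funE. Qed.

Let gal_permM : {in 'Gal({:L} / 1)%g &, {morph gal_perm : s t / (s * t)%g}}.
Proof.
move=> s t _ _; apply/ffunP => i; apply/permP => l; apply: (x_inj (i := i)).
by rewrite gal_permE galM ?memvf // mulg_ffun permM !gal_permE.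
Qed.

Let gal_fixes (s t : gal_of {:L}) : (forall i l, s (x i l) = t (x i l)) -> s = t.
Proof.
move=> eq_st; pose u := (s * t^-1)%g.
have uM a : u a = (t^-1)%g (s a) by rewrite galM ?memvf.
have ux i l : u (x i l) = x i l.
  by rewrite uM eq_st -galM ?memvf // mulgV gal_id.
suffices u1 : u = 1%g by apply/eqP; rewrite eq_mulgV1 -/u u1.
apply/eqP/gal_eqP => a _; rewrite gal_id; apply/fixedSpaceP.
suffices: ({:L} <= fixedSpace u)%VS by move/subvP; apply; apply: memvf.
have sL : ({:L} <= <<1 & [seq x j l | j <- enum I, l <- enum 'I_(r j)]>>)%VS.
  by rewrite -L_generated.
apply: (subv_trans sL); apply/(@Fadjoin_seqP _ _ _ _ [aspace of fixedSpace u]).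
split; first exact: sub1v.
by move=> _ /allpairsPdep[i [l [_ _ ->]]]; apply/fixedSpaceP.
Qed.

Let gal_sub i : 'Gal({:L} / U i)%g \subset 'Gal({:L} / 1)%g.
Proof. exact: galS (sub1v _). Qed.

Let gal_others i j l s : s \in 'Gal({:L} / U i)%g -> j != i -> s (x j l) = x j l.
Proof.
move=> Gs ne_ji; apply: (fixed_gal (subvf _) Gs).
by apply: seqv_sub_adjoin; apply: x_others.
Qed.

(** By [gal_fixes], the automorphisms over [U i] inject into the permutations of
    the roots of the [i]-th factor, and by [card_gal] they are not fewer. *)
Let gal_onto i (g : 'S_(r i)) : exists2 s, s \in 'Gal({:L} / U i)%g & gal_perm s i = g.
Proof.
suffices: g \in [set gal_perm s i | s in 'Gal({:L} / U i)%g].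
  by case/imsetP=> s Gs ->; exists s.
suffices -> : [set gal_perm s i | s in 'Gal({:L} / U i)%g] = [set: 'S_(r i)] by rewrite inE.
apply/eqP; rewrite eqEcard subsetT cardsT card_Sn card_in_imset ?card_gal //.
move=> s t Gs Gt eq_st; apply: gal_fixes => j l.
have [eq_ji | ne_ji] := eqVneq j i; last by rewrite !(gal_others _ _ ne_ji).
by move: l; rewrite eq_ji => l; rewrite -!gal_permE eq_st.
Qed.

Let gal_perm_morphism := Morphism gal_permM.

Local Open Scope group_scope.

Theorem gal_components : 'Gal({:L} / 1) \isog setXn (fun i => [set: 'S_(r i)]).
Proof.
have inj : ('injm gal_perm_morphism)%g.
  apply/injmP => s t Gs Gt eq_st; apply: gal_fixes => j l.
  by rewrite -!gal_permE; move: eq_st => /= ->.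
suffices <- : gal_perm_morphism @* 'Gal({:L} / 1) = setXn (fun i => [set: 'S_(r i)]).
  exact: sub_isog.
apply/eqP; rewrite eqEsubset; apply/andP; split.
  by apply/subsetP=> f _; apply/setXnP => i; rewrite inE.
have DX := setXn_prod (fun i => [set: 'S_(r i)]%G).
apply: (eq_ind _ (fun X : {set _} => X \subset _) _ _ DX).
rewrite prod_subG // => i _; apply/subsetP => _ /set1gXnP[g _ ->].
have [s Gs Ds] := gal_onto g.
have -> : dfung1 g = gal_perm_morphism s.
  apply/ffunP => j; have [<- | ne_ij] := eqVneq i j; first by rewrite dfung1_id.
  rewrite dfung1_dflt //; apply/permP => l; apply: (x_inj (i := j)).
  by rewrite perm1 gal_permE (gal_others _ Gs) // eq_sym.
by rewrite mem_morphim // (subsetP (gal_sub i)).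
Qed.

End ComponentGroups.

Section Groups.

Local Open Scope group_scope.

Lemma isog_setXn_unit (gT : finGroupType) (G : {group gT}) :
  setXn (fun _ : unit => G : {set gT}) \isog G.
Proof.
have := setXn_prod (fun _ : unit => G); rewrite (big_pred1 tt) => [<-|[]//].
by rewrite isog_sym (@isog_setXn unit (fun _ => gT) tt G).
Qed.

Lemma isog_setXn_bool (gT : bool -> finGroupType) (G : forall b, {group gT b})
    (hT1 hT2 : finGroupType) (H1 : {group hT1}) (H2 : {group hT2}) :
  H1 \isog G true -> H2 \isog G false ->
  setXn (fun b => G b : {set gT b}) \isog setX H1 H2.
Proof.
move=> iso1 iso2; have := setXn_dprod G; rewrite big_bool => defG.
rewrite isog_sym; apply: isog_dprod (setX_dprod H1 H2) defG _ _.
  apply: isog_trans (isog_setXn (G true)).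
  by apply: isog_trans iso1; rewrite isog_sym isog_setX1.
apply: isog_trans (isog_setXn (G false)).
by apply: isog_trans iso2; rewrite isog_sym isog_set1X.
Qed.

Lemma tutte_galois (K : fieldType) (E : finType) (M : matroid E) (I : finType)
    (E_ : I -> {set E}) (r : I -> nat) :
    matroid_sum M E_ -> (forall i, minor_connected M (E_ i) set0) ->
    (forall i, r i = mrk M (E_ i)) ->
  forall L : splittingFieldType (Kv K E), splitting_field (tutte K M) L ->
  'Gal({:L} / 1) \isog setXn (fun i => [set: 'S_(r i)]).
Proof.
move=> sumM connE rE L; rewrite (tutte_prod sumM) => splitL.
have P_neq0 : (\prod_i minor_tutte M (@var K E) (E_ i) set0 != 0)%R.
  have [zs Dzs _] := splitL; apply/eqP=> P0; move: Dzs.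
  by rewrite P0 rmorph0 eqp_sym eqp0 (negPf (monic_neq0 (monic_prod_XsubC _ _ _))).
have ind := @algindep_var K E; have univ := @universal_var K E.
have /fin_all_exists[x Dx] := component_roots sumM connE ind univ rE P_neq0 splitL.
exact: (gal_components sumM connE ind univ rE P_neq0 splitL Dx).
Qed.

(** A connected matroid is a direct sum with one summand. *)
Lemma connected_tutte_galois (K : fieldType) (E : finType) (M : matroid E) :
  connected_matroid M ->
  forall L : splittingFieldType (Kv K E), splitting_field (tutte K M) L ->
  'Gal({:L} / 1) \isog [set: 'S_(mrank M)].
Proof.
move=> /connected_matroid_minor connM L splitL.
have sumM : matroid_sum M (fun _ : unit => [set: E]).
  split=> [[] [] //||X]; first by rewrite (big_pred1 tt) // => -[].
  by rewrite (big_pred1 tt) ?setIT // => -[].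
have iso := tutte_galois (r := fun _ => mrank M) sumM (fun _ => connM) (fun _ => erefl) splitL.
by apply: isog_trans iso _; apply: isog_setXn_unit.
Qed.

End Groups.

Theorem mainTheorem3 (K : fieldType) :
  (forall (E : finType) (M : matroid E) (E1 E2 : {set E})
      (M1 : matroid {x : E | x \in E1}) (M2 : matroid {x : E | x \in E2}),
    connected_matroid M1 -> connected_matroid M2 -> direct_sum2 M M1 M2 ->
    forall (L : splittingFieldType (Kv K E))
           (L1 : splittingFieldType (Kv K {x : E | x \in E1}))
           (L2 : splittingFieldType (Kv K {x : E | x \in E2})),
      splitting_field (tutte K M) L ->
      splitting_field (tutte K M1) L1 ->
      splitting_field (tutte K M2) L2 ->
      ('Gal({:L} / 1) \isog setX 'Gal({:L1} / 1) 'Gal({:L2} / 1))%g)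
  /\
  (forall (E : finType) (M : matroid E),
    (exists (k : nat) (E_ : 'I_k -> {set E})
            (M_ : forall i, matroid {x : E | x \in E_ i}),
        (forall i, connected_matroid (M_ i)) /\ direct_sum M M_) /\
    forall (k : nat) (E_ : 'I_k -> {set E})
           (M_ : forall i, matroid {x : E | x \in E_ i}),
      (forall i, connected_matroid (M_ i)) -> direct_sum M M_ ->
      forall L : splittingFieldType (Kv K E),
        splitting_field (tutte K M) L ->
        ('Gal({:L} / 1) \isog setXn (fun i => [set: 'S_(mrank (M_ i))]))%g).
Proof.
split=> [E M E1 E2 M1 M2 conn1 conn2 sumM L L1 L2 split split1 split2 | E M].
  have [res1 res2 sumE] := direct_sum2_restriction sumM.
  pose r (b : bool) := if b then mrank M1 else mrank M2.
  have iso : ('Gal({:L} / 1) \isog setXn (fun b => [set: 'S_(r b)]))%g.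
    apply: (tutte_galois sumE) split => -[].
    - exact/(connected_restriction res1).
    - exact/(connected_restriction res2).
    - exact: mrank_restriction res1.
    - exact: mrank_restriction res2.
  apply: isog_trans iso _; apply: (isog_setXn_bool (G := fun b => [set: 'S_(r b)]%G)).
    exact: connected_tutte_galois.
  exact: connected_tutte_galois.
split; first exact: connected_decomposition.
move=> k E_ M_ connM sumM L; have [res sumE] := direct_sum_restriction sumM.
apply: (tutte_galois sumE) => i; first exact/(connected_restriction (res i)).
exact: mrank_restriction (res i).
Qed.
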